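(* There exist positive numbers $c$ and $\epsilon_0$ and unit vectors $\hat{v}^{(1)},\dots,\hat{v}^{(9)}\in\mathbb{R}^3$ with the following property. Let $\hat{\mathcal{U}}$ be any single-qubit unitary channel and let $\epsilon\in(0,\epsilon_0]$. Let $\hat{\mathcal{U}}_1,\dots,\hat{\mathcal{U}}_9$ be single-qubit unitary channels satisfying $$\tfrac12\big[\mathcal{J}(\hat{\mathcal{U}}_j\circ\hat{\mathcal{U}}^{-1})\big]_{MB}=\hat e^{(j)}\hat e^{(j)T},\qquad \hat e^{(j)}=\begin{pmatrix}\sqrt{1-(c\epsilon)^2}\\ c\epsilon\,\hat v^{(j)}\end{pmatrix}\in\mathbb{R}^4,$$ and let $\mathcal{U}_1,\dots,\mathcal{U}_9$ be any single-qubit unitary channels with $\tfrac12\|\hat{\mathcal{U}}_j-\mathcal{U}_j\|_\diamond\le\epsilon$ for all $j$. Then there exists a probability distribution $(p_j)_{j=1}^9$ such that the remnant error $\mathcal{E}_{\rm rem}=\big(\sum_j p_j\mathcal{U}_j\big)\circ\hat{\mathcal{U}}^{-1}$ is a depolarizing channel, i.e. $\mathcal{E}_{\rm rem}(\rho)=(1-3q)\rho+q(X\rho X+Y\rho Y+Z\rho Z)$ for some $q\ge0$. Moreover, for the probability distribution $p$ that minimizes $\tfrac12\|\hat{\mathcal{U}}-\sum_j p_j\mathcal{U}_j\|_\diamond$ among all probability distributions on $\{1,\dots,9\}$ for which $\mathcal{E}_{\rm rem}$ is a depolarizing channel, $$((c-1)\epsilon)^2\le \tfrac12\Big\|\hat{\mathcal{U}}-\sum_{j=1}^9p_j\mathcal{U}_j\Big\|_\diamond\le((c+1)\epsilon)^2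 .$$
   Context: A single-qubit unitary channel is $\mathcal{U}(\rho)=U\rho U^\dagger$ with $U\in U(2)$. $\|\cdot\|_\diamond$ is the diamond norm. For a linear map $\Phi$ on $2\times2$ matrices, the Choi operator is $\mathcal{J}(\Phi)=(\mathrm{Id}\otimes\Phi)(|\Omega\rangle\langle\Omega|)$ with the unnormalized $|\Omega\rangle=|00\rangle+|11\rangle$. The magic basis is $|\Psi_1\rangle=\frac{1}{\sqrt2}(|00\rangle+|11\rangle)$, $|\Psi_2\rangle=\frac{i}{\sqrt2}(|00\rangle-|11\rangle)$, $|\Psi_3\rangle=\frac{i}{\sqrt2}(|01\rangle+|10\rangle)$, $|\Psi_4\rangle=\frac{1}{\sqrt2}(|01\rangle-|10\rangle)$, and $[A]_{MB}$ denotes the $4\times4$ matrix with entries $([A]_{MB})_{ij}=\langle\Psi_i|A|\Psi_j\rangle$. For every single-qubit unitary channel $\mathcal{U}$ one has $\tfrac12[\mathcal{J}(\mathcal{U})]_{MB}=rr^T$ for a real unit vector $r\in\mathbb{R}^4$. $X,Y,Z$ are the Pauli matrices. *)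

(* Defs.v *)
From HB Require Import structures.
From mathcomp Require Import all_boot all_order all_algebra.
From mathcomp Require Import complex.
From mathcomp Require Import classical_sets reals.

Set Implicit Arguments.
Unset Strict Implicit.
Unset Printing Implicit Defensive.

Import Order.TTheory GRing.Theory Num.Theory.
Local Open Scope ring_scope.
Local Open Scope complex_scope.
Local Open Scope classical_set_scope.

Section QubitDefs.
Variable R : realType.
Local Notation C := R[i].

Definition rc (r : R) : C := r%:C.

Definition adjmx {m n} (M : 'M[C]_(m, n)) : 'M[C]_(n, m) :=
  \matrix_(i, j) (M j i)^*.

Definition uch (U : 'M[C]_2) : 'M[C]_2 -> 'M[C]_2 :=
  fun rho => U *m rho *m adjmx U.

Definition chsub (F G : 'M[C]_2 -> 'M[C]_2) : 'M[C]_2 -> 'M[C]_2 :=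
  fun rho => F rho - G rho.

Definition mixch (p : 'I_9 -> R) (U : 'I_9 -> 'M[C]_2) : 'M[C]_2 -> 'M[C]_2 :=
  fun rho => \sum_(j < 9) rc (p j) *: uch (U j) rho.

Definition probdist (p : 'I_9 -> R) : Prop :=
  (forall j, 0 <= p j) /\ \sum_(j < 9) p j = 1.

(* two-qubit computational basis: |ab> has index 2a+b (first factor = ancilla) *)
Definition idx4 (a b : 'I_2) : 'I_4 := @inord 3 (a * 2 + b)%N.
Definition hi (i : 'I_4) : 'I_2 := @inord 1 (i %/ 2)%N.
Definition lo (i : 'I_4) : 'I_2 := @inord 1 (i %% 2)%N.

(* (Id (x) Phi)(X) for X a 4x4 matrix on C^2 (x) C^2 *)
Definition idtens (F : 'M[C]_2 -> 'M[C]_2) (X : 'M[C]_4) : 'M[C]_4 :=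
  \matrix_(i, j)
     F (\matrix_(k, l) X (idx4 (hi i) k) (idx4 (hi j) l)) (lo i) (lo j).

Definition omega : 'cV[C]_4 := \col_i (if hi i == lo i then 1 else 0).

Definition choi (F : 'M[C]_2 -> 'M[C]_2) : 'M[C]_4 :=
  idtens F (omega *m adjmx omega).

(* magic basis; coefficient tables in the basis |00>,|01>,|10>,|11> *)
Definition s2 : C := rc (Num.sqrt 2)^-1.
Definition magic_tbl : seq (seq C) :=
  [:: [:: s2; 0; 0; s2];
      [:: 'i * s2; 0; 0; - ('i * s2)];
      [:: 0; 'i * s2; 'i * s2; 0];
      [:: 0; s2; - s2; 0]].
Definition psi (k : 'I_4) : 'cV[C]_4 :=
  \col_i nth 0 (nth [::] magic_tbl k) i.

Definition mb (A : 'M[C]_4) : 'M[C]_4 :=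
  \matrix_(i, j) (adjmx (psi i) *m A *m psi j) 0 0.

Definition psd {n} (P : 'M[C]_n) : Prop :=
  P = adjmx P /\ forall v : 'cV[C]_n, 0 <= (adjmx v *m P *m v) 0 0.

(* trace norm ||X||_1 = tr sqrt(X^dagger X), where sqrt(.) is the
   (unique) positive semidefinite square root *)
Definition trnorm {n} (X : 'M[C]_n) : R :=
  sup [set r : R | exists P : 'M[C]_n,
         [/\ psd P, P *m P = adjmx X *m X & rc r = \tr P]].

Definition diamond (F : 'M[C]_2 -> 'M[C]_2) : R :=
  sup [set r : R | exists X : 'M[C]_4, trnorm X <= 1 /\ r = trnorm (idtens F X)].

Definition pX : 'M[C]_2 := \matrix_(i, j) (if i == j then 0 else 1).
Definition pY : 'M[C]_2 :=
  \matrix_(i, j) (if i == j then 0 else if (i == 0 :> nat) then - 'i else 'i).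
Definition pZ : 'M[C]_2 :=
  \matrix_(i, j) (if i == j then (if (i == 0 :> nat) then 1 else -1) else 0).

Definition depolarizing (F : 'M[C]_2 -> 'M[C]_2) : Prop :=
  exists q : R, 0 <= q /\ forall rho : 'M[C]_2,
    F rho = rc (1 - 3 * q) *: rho
            + rc q *: (pX *m rho *m pX + pY *m rho *m pY + pZ *m rho *m pZ).

Definition ehat (c eps : R) (v : 'I_3 -> R) (a : 'I_4) : R :=
  if (a == 0 :> nat) then Num.sqrt (1 - (c * eps) ^+ 2)
  else c * eps * v (@inord 2 a.-1).

End QubitDefs.

(* Main.v *)
Require Import Defs.
From HB Require Import structures.
From mathcomp Require Import all_boot all_order all_algebra.
From mathcomp Require Import complex.
From mathcomp Require Import classical_sets reals.
From mathcomp Require Import ring lra.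
Import Order.TTheory GRing.Theory Num.Theory.
Local Open Scope ring_scope.

Set Implicit Arguments.
Unset Strict Implicit.
Unset Printing Implicit Defensive.

(** Write <<A>> for the vectorization of a 2x2 matrix.  Up to a phase, a qubit
unitary is a real unit vector r in the magic basis, and its Choi operator is
r r^T.  Hence a mixture of the channels U_j o Uhat^-1 with weights p_j is
depolarizing iff the matrix sum_j p_j r_j r_j^T is diag(1-3q, q, q, q).

Write r_j = (a_j, c eps u_j).  The conditions on p form a square linear system
with coefficients (a u, u_k u_l, u_1^2 - u_2^2, u_1^2 - u_3^2, 1).  For the
chosen directions v_j the unperturbed system (a = 1, u = v_j) is invertible and
has a positive solution.  The diamond-norm hypothesis gives |r_j - e_j| =
O(eps), so |u_j - v_j| = O(1/c), and for c large and eps small the perturbed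
system still has exactly one solution, which is positive.  The feasible set is
therefore a single point, and the minimality in the statement is automatic.

For this p the diamond distance is 3q = sum_j p_j |w_j|^2 with w_j = c eps u_j,
and (c-1) eps <= |w_j| <= (c+1) eps by the triangle inequality for the sine of
the angle between unit vectors.  The two diamond norms needed (the difference
of two unitary channels from below, and a depolarizing channel minus the
identity exactly) are computed by testing on a maximally entangled state, with
the trace norm controlled by duality with partial isometries. *)

(** * Trace norm *)

HB.instance Definition _ (R : realType) := GRing.RMorphism.copy (@rc R) (real_complex R).

Section Adjoint.
Variable R : realType.
Local Notation C := R[i].

Lemma adjmxE m n (M : 'M[C]_(m, n)) : adjmx M = map_mx Num.conj M^T.
Proof. by apply/matrixP => i j; rewrite !mxE. Qed.

Lemma adjmxK m n (M : 'M[C]_(m, n)) : adjmx (adjmx M) = M.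
Proof. by apply/matrixP => i j; rewrite !mxE conjcK. Qed.

Lemma adjmxM m n p (A : 'M[C]_(m, n)) (B : 'M[C]_(n, p)) :
  adjmx (A *m B) = adjmx B *m adjmx A.
Proof.
apply/matrixP => i j; rewrite !mxE rmorph_sum; apply: eq_bigr => k _.
by rewrite !mxE rmorphM mulrC.
Qed.

Lemma adjmxB m n (A B : 'M[C]_(m, n)) : adjmx (A - B) = adjmx A - adjmx B.
Proof. by apply/matrixP => i j; rewrite !mxE rmorphB. Qed.

Lemma adjmxZ m n (a : C) (A : 'M[C]_(m, n)) : adjmx (a *: A) = Num.conj a *: adjmx A.
Proof. by apply/matrixP => i j; rewrite !mxE rmorphM. Qed.

Lemma conj_rc (a : R) : Num.conj (rc a) = rc a.
Proof. exact: conjc_real. Qed.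

Lemma adjmx1 n : adjmx (1%:M : 'M[C]_n) = 1%:M.
Proof. by apply/matrixP => i j; rewrite !mxE eq_sym rmorph_nat. Qed.

Lemma adjmx_diag n (d : 'rV[R]_n) :
  adjmx (diag_mx (map_mx (@rc R) d)) = diag_mx (map_mx (@rc R) d).
Proof.
apply/matrixP => i j; rewrite !mxE eq_sym; case: eqP => [->|_].
  by rewrite !mulr1n; apply: conj_rc.
by rewrite !mulr0n conjc0.
Qed.

Lemma adjmx_delta m n i j : adjmx (delta_mx i j : 'M[C]_(m, n)) = delta_mx j i.
Proof. by apply/matrixP => k l; rewrite !mxE andbC conjc_nat. Qed.

Lemma mxtrace_adj n (A : 'M[C]_n) : \tr (adjmx A) = Num.conj (\tr A).
Proof. by rewrite rmorph_sum; apply: eq_bigr => i _; rewrite mxE. Qed.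

Lemma sqnE n (x : 'cV[C]_n) : (adjmx x *m x) 0 0 = \sum_k `|x k 0| ^+ 2.
Proof. by rewrite mxE; apply: eq_bigr => k _; rewrite mxE sqr_normc mulrC. Qed.

Lemma sqn_ge0 n (x : 'cV[C]_n) : 0 <= (adjmx x *m x) 0 0.
Proof. by rewrite sqnE sumr_ge0 // => k _; rewrite exprn_ge0. Qed.

(** The diagonal entries of [adjmx A *m A] are the squared norms of the columns of [A]. *)
Lemma adjmx_mul_eq0 m n (A : 'M[C]_(m, n)) : adjmx A *m A = 0 -> A = 0.
Proof.
move=> A0; apply/matrixP => i j; rewrite mxE.
have : (adjmx A *m A) j j = 0 by rewrite A0 mxE.
rewrite mxE => /eqP; rewrite psumr_eq0 => [/allP /(_ i)|k _].
  rewrite mem_index_enum => /(_ isT) /=.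
  by rewrite mxE mulrC -sqr_normc expf_eq0 normr_eq0 => /eqP.
by rewrite mxE mulrC -sqr_normc exprn_ge0.
Qed.

Lemma unitarymx_adj n (V : 'M[C]_n) : V \is unitarymx -> V *m adjmx V = 1%:M.
Proof. by rewrite adjmxE => /unitarymxP. Qed.

Lemma adj_unitarymx n (V : 'M[C]_n) : V \is unitarymx -> adjmx V *m V = 1%:M.
Proof. by move=> /unitarymx_adj /mulmx1C. Qed.

Lemma mulmx_unitaryK m n (A : 'M[C]_(m, n)) (V : 'M[C]_n) :
  V \is unitarymx -> A *m V *m adjmx V = A.
Proof. by move=> VU; rewrite -mulmxA unitarymx_adj // mulmx1. Qed.

Lemma mulmx_unitaryVK m n (A : 'M[C]_(m, n)) (V : 'M[C]_n) :
  V \is unitarymx -> A *m adjmx V *m V = A.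
Proof. by move=> VU; rewrite -mulmxA adj_unitarymx // mulmx1. Qed.

Lemma unitarymx_adjmx n (V : 'M[C]_n) : V \is unitarymx -> adjmx V \is unitarymx.
Proof. by move=> VU; apply/unitarymxP; rewrite -adjmxE adjmxK adj_unitarymx. Qed.

Lemma rc_ge0 (a : R) : (0 <= rc a) = (0 <= a).
Proof. exact: ler0c. Qed.

Lemma rc_le (a b : R) : (rc a <= rc b) = (a <= b).
Proof. exact: lecR. Qed.

Lemma mxtraceB n (A B : 'M[C]_n) : \tr (A - B) = \tr A - \tr B.
Proof. exact: raddfB. Qed.

Lemma rc_ReK (z : C) : 0 <= z -> rc (complex.Re z) = z.
Proof. by case: z => a b; rewrite lecE /= => /andP[/eqP -> _]. Qed.

(** A Hermitian matrix is normal, so the spectral theorem applies. Each eigenvalue is the quadratic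
    form of [P] at an eigenvector, hence real and nonnegative. *)
Lemma psd_spectral n (P : 'M[C]_n) : psd P ->
  exists (V : 'M[C]_n) (d : 'rV[R]_n), [/\ V \is unitarymx,
    forall i, 0 <= d 0 i & P = adjmx V *m diag_mx (map_mx (@rc R) d) *m V].
Proof.
case=> Padj Pge0.
have Pn : P \is normalmx by apply/normalmxP; rewrite -adjmxE -Padj.
have /orthomx_spectralP := Pn.
have := spectral_unitarymx P.
move: (spectralmx P) (spectral_diag P) => V sp VU.
rewrite invmx_unitary // -adjmxE => PE.
have spE i : sp 0 i = (adjmx (adjmx V *m (delta_mx i 0 : 'cV_n)) *m P
                         *m (adjmx V *m (delta_mx i 0 : 'cV_n))) 0 0.
  rewrite adjmxM adjmxK adjmx_delta [in RHS]PE !mulmxA.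
  rewrite !(mulmx_unitaryK _ VU).
  rewrite mxE (bigD1 i) //= big1 => [|k /negPf ki]; last by rewrite !mxE ki mulr0.
  rewrite addr0 mxE (bigD1 i) //= big1 => [|k /negPf ki].
    by rewrite !mxE !eqxx mulr1n mul1r mulr1 addr0.
  by rewrite !mxE ki mul0r.
have sp_ge0 i : 0 <= sp 0 i by rewrite spE.
have spK : map_mx (@rc R) (map_mx (@complex.Re R) sp) = sp.
  by apply/rowP => i; rewrite !mxE rc_ReK.
exists V, (map_mx (@complex.Re R) sp); rewrite spK; split; [exact: VU | | exact: PE].
by move=> i; rewrite mxE -rc_ge0 rc_ReK.
Qed.

Lemma psd_adj_mul n (X : 'M[C]_n) : psd (adjmx X *m X).
Proof.
split=> [|v]; first by rewrite adjmxM adjmxK.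
by rewrite mulmxA -adjmxM -mulmxA sqn_ge0.
Qed.

Lemma psd_diag n (V : 'M[C]_n) (d : 'rV[R]_n) : (forall i, 0 <= d 0 i) ->
  psd (adjmx V *m diag_mx (map_mx (@rc R) d) *m V).
Proof.
move=> d0; set e := map_mx Num.sqrt d.
suff -> : diag_mx (map_mx (@rc R) d) =
   adjmx (diag_mx (map_mx (@rc R) e)) *m diag_mx (map_mx (@rc R) e).
  by rewrite mulmxA -adjmxM -mulmxA; apply: psd_adj_mul.
rewrite adjmx_diag mulmx_diag; congr diag_mx; apply/rowP => i.
by rewrite !mxE -rmorphM -expr2 sqr_sqrtr.
Qed.

Lemma psd_sqrt n (H : 'M[C]_n) : psd H -> exists2 P, psd P & P *m P = H.
Proof.
move=> /psd_spectral[V [d [VU d0 ->]]].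
exists (adjmx V *m diag_mx (map_mx (@rc R) (map_mx Num.sqrt d)) *m V).
  by apply: psd_diag => i; rewrite mxE sqrtr_ge0.
rewrite !mulmxA (mulmx_unitaryK _ VU) -(mulmxA (adjmx V)) mulmx_diag.
suff -> : (\row_i (map_mx (@rc R) (map_mx Num.sqrt d) 0 i * map_mx (@rc R) (map_mx Num.sqrt d) 0 i))
  = map_mx (@rc R) d by [].
by apply/rowP => i; rewrite !mxE -rmorphM -expr2 sqr_sqrtr.
Qed.

(** * Partial isometries and trace-norm duality *)

Definition pisom m n (W : 'M[C]_(m, n)) := W *m adjmx W *m W = W.

Lemma pisom_adj m n (W : 'M[C]_(m, n)) : pisom W -> pisom (adjmx W).
Proof. by move=> WW; rewrite /pisom -[in RHS]WW !adjmxM adjmxK mulmxA. Qed.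

Lemma unitarymx_pisom n (V : 'M[C]_n) : V \is unitarymx -> pisom V.
Proof. by move=> VU; rewrite /pisom unitarymx_adj // mul1mx. Qed.

Lemma pisom_mulu n (W V : 'M[C]_n) : V \is unitarymx -> pisom W -> pisom (W *m V).
Proof.
move=> VU WW; by rewrite /pisom adjmxM !mulmxA (mulmx_unitaryK _ VU) WW.
Qed.

Lemma pisom_umul n (W V : 'M[C]_n) : V \is unitarymx -> pisom W -> pisom (V *m W).
Proof.
move=> VU WW; by rewrite /pisom adjmxM !mulmxA (mulmx_unitaryVK _ VU) -!mulmxA !(mulmxA W) WW.
Qed.

(** [Q = W^* W] is an orthogonal projection, and [|x|^2 - |W x|^2 = |x - Q x|^2]. *)
Lemma pisom_contract m n (W : 'M[C]_(m, n)) (x : 'cV[C]_n) : pisom W ->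
  (adjmx (W *m x) *m (W *m x)) 0 0 <= (adjmx x *m x) 0 0.
Proof.
move=> WW; have [Q QE] : exists Q, Q = adjmx W *m W by exists (adjmx W *m W).
have QQ : Q *m Q = Q by rewrite QE -mulmxA !(mulmxA W) WW.
have Qa : adjmx Q = Q by rewrite QE adjmxM adjmxK.
rewrite -subr_ge0.
suff -> : (adjmx x *m x) 0 0 - (adjmx (W *m x) *m (W *m x)) 0 0
   = (adjmx (x - Q *m x) *m (x - Q *m x)) 0 0 by apply: sqn_ge0.
transitivity ((adjmx x *m x - adjmx (W *m x) *m (W *m x)) 0 0); first by rewrite !mxE.
congr (fun_of_matrix _ 0 0).
rewrite adjmxB !adjmxM Qa mulmxBl !mulmxBr !mulmxA.
rewrite -[adjmx x *m Q *m Q]mulmxA QQ (subrr (adjmx x *m Q *m x)) subr0.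
by rewrite -[adjmx x *m adjmx W *m W]mulmxA QE.
Qed.

(** A product of contractions sends a basis vector to a vector of norm at most 1, and the diagonal
    entry is one of its coordinates. In [pisom_dual] the outer factors come from the polar
    decomposition. *)
Lemma pisom3_diag n (A B W : 'M[C]_n) i : pisom A -> pisom B -> pisom W ->
  `|(A *m W *m B) i i| <= 1.
Proof.
move=> hA hB hW; set Z := _ *m B.
pose e : 'cV[C]_n := delta_mx i 0.
have e1 : (adjmx e *m e) 0 0 = 1.
  rewrite sqnE (bigD1 i) //= big1 => [|k /negPf ki].
    by rewrite !mxE !eqxx normr1 expr1n addr0.
  by rewrite !mxE ki normr0 expr0n.
have : (adjmx (Z *m e) *m (Z *m e)) 0 0 <= 1.
  rewrite -e1 /Z -!mulmxA; apply: le_trans (pisom_contract _ hA) _.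
  by apply: le_trans (pisom_contract _ hW) _; apply: pisom_contract.
rewrite sqnE => le1.
have : `|Z i i| ^+ 2 <= 1.
  apply: le_trans le1; rewrite (bigD1 i) //=.
  have -> : (Z *m e) i 0 = Z i i.
    by rewrite /e -colE mxE.
  by rewrite lerDl sumr_ge0 // => k _; rewrite exprn_ge0.
by rewrite -{1}(expr1n _ 2) ler_pXn2r // nnegrE.
Qed.

(* [U] is [X V^* D^-1] with the convention [0^-1 = 0]; it is only a partial
   isometry when [X] is singular. *)
Lemma polar n (P X : 'M[C]_n) : psd P -> P *m P = adjmx X *m X ->
  exists (U V : 'M[C]_n) (d : 'rV[R]_n),
   [/\ V \is unitarymx, pisom U, forall i, 0 <= d 0 i,
       P = adjmx V *m diag_mx (map_mx (@rc R) d) *m V &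
       X = U *m diag_mx (map_mx (@rc R) d) *m V /\
       adjmx U *m X *m adjmx V = diag_mx (map_mx (@rc R) d)].
Proof.
move=> /psd_spectral[V [d [VU d0 PE]]] PP.
set D := diag_mx (map_mx (@rc R) d) in PE *.
set D' := diag_mx (map_mx (@rc R) (map_mx GRing.inv d)).
(* As [0 / 0 = 0], this is the 0-1 projection onto the nonzero entries of [d]. *)
set E := diag_mx (map_mx (@rc R) (\row_i (d 0 i / d 0 i))).
have Da : adjmx D = D by apply: adjmx_diag.
have D'a : adjmx D' = D' by apply: adjmx_diag.
have Ea : adjmx E = E by apply: adjmx_diag.
have diagM (a b c : 'rV[R]_n) : (forall i, a 0 i * b 0 i = c 0 i) ->
    diag_mx (map_mx (@rc R) a) *m diag_mx (map_mx (@rc R) b) = diag_mx (map_mx (@rc R) c).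
  move=> abc; rewrite mulmx_diag; congr diag_mx; apply/rowP => i.
  by rewrite !mxE -abc rmorphM.
have D'D : D' *m D = E by apply: diagM => i; rewrite !mxE mulrC.
have DD' : D *m D' = E by apply: diagM => i; rewrite !mxE.
have idem (a : R) : a * (a / a) = a.
  by have [->|a0] := eqVneq a 0; rewrite ?mul0r // divff // mulr1.
have DE : D *m E = D by apply: diagM => i; rewrite !mxE idem.
have ED : E *m D = D by apply: diagM => i; rewrite !mxE mulrC idem.
have D'E : D' *m E = D'.
  apply: diagM => i; rewrite !mxE; have [->|a0] := eqVneq (d 0 i) 0.
    by rewrite invr0 !mul0r.
  by rewrite divff // mulr1.
have VHV : V *m (adjmx X *m X) *m adjmx V = D *m D.
  by rewrite -PP PE !mulmxA unitarymx_adj // mul1mx !(mulmx_unitaryK _ VU).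
set U := X *m adjmx V *m D'.
have UU : adjmx U *m U = E.
  rewrite /U !adjmxM adjmxK D'a.
  transitivity (D' *m (V *m (adjmx X *m X) *m adjmx V) *m D').
    by rewrite !mulmxA.
  by rewrite VHV !mulmxA D'D ED DD'.
have UE : U *m E = U by rewrite /U -!mulmxA D'E.
exists U, V, d; split; [exact: VU | by rewrite /pisom -mulmxA UU UE | exact: d0 | exact: PE |].
split.
  rewrite /U -[_ *m D' *m _]mulmxA D'D.
  (* The Gram matrix of [X V^*] is [D^2], so [X V^*] vanishes wherever [D] does, that is, on the
     range of [1 - E]. *)
  have XE : X *m adjmx V - X *m adjmx V *m E = 0.
    have -> : X *m adjmx V - X *m adjmx V *m E = X *m adjmx V *m (1%:M - E).
      by rewrite mulmxBr mulmx1.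
    apply: adjmx_mul_eq0; rewrite !adjmxM adjmxK.
    transitivity (adjmx (1%:M - E) *m (V *m (adjmx X *m X) *m adjmx V) *m (1%:M - E)).
      by rewrite !mulmxA.
    by rewrite VHV -!mulmxA (mulmxBr D) mulmx1 DE (subrr D) !mulmx0.
  have /subr0_eq <- := XE.
  by rewrite (mulmx_unitaryVK _ VU).
rewrite /U !adjmxM adjmxK D'a.
transitivity (D' *m (V *m (adjmx X *m X) *m adjmx V)); first by rewrite !mulmxA.
by rewrite VHV mulmxA D'D ED.
Qed.

(** With [X = U D V], the trace of [W X] is the sum of [(V W U) i i * d i], whose coefficients have
    modulus at most 1. The choice [W = V^* U^*] attains the sum of the [d i]. *)
Lemma pisom_dual n (P X : 'M[C]_n) : psd P -> P *m P = adjmx X *m X ->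
  (forall W, pisom W -> `|\tr (W *m X)| <= \tr P) /\
  exists2 W, pisom W & \tr (W *m X) = \tr P.
Proof.
move=> hP PP; have [U [V [d [VU hU d0 PE [XE DE]]]]] := polar hP PP.
have trP : \tr P = \sum_i rc (d 0 i).
  rewrite PE -mulmxA mxtrace_mulC -mulmxA unitarymx_adj // mulmx1 mxtrace_diag.
  by apply: eq_bigr => i _; rewrite mxE.
split=> [W hW|].
  rewrite XE !mulmxA mxtrace_mulC !mulmxA trP.
  rewrite (_ : \tr _ = \sum_i (V *m W *m U) i i * rc (d 0 i)).
    apply: le_trans (ler_norm_sum _ _ _) _; apply: ler_sum => i _.
    rewrite normrM (ger0_norm (x := rc _)) ?rc_ge0 // ler_piMl ?rc_ge0 //.
    by apply: pisom3_diag => //; apply: unitarymx_pisom.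
  apply: eq_bigr => i _.
  rewrite mxE (bigD1 i) //= big1 => [|k /negPf ki].
    by rewrite !mxE eqxx addr0.
  by rewrite !mxE ki mulr0.
exists (adjmx V *m adjmx U).
  by apply: pisom_umul; [apply: unitarymx_adjmx | apply: pisom_adj].
rewrite -mulmxA mxtrace_mulC DE mxtrace_diag trP.
by apply: eq_bigr => i _; rewrite mxE.
Qed.

(** By duality the traces of two positive roots bound each other, so the set under the supremum in
    [trnorm] is a singleton. *)
Lemma trnormE n (P X : 'M[C]_n) : psd P -> P *m P = adjmx X *m X ->
  rc (trnorm X) = \tr P.
Proof.
move=> hP PP; have [d1 [W hW dW]] := pisom_dual hP PP.
have tr0 : 0 <= \tr P by apply: le_trans (d1 _ hW).
rewrite -(rc_ReK tr0); congr rc.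
rewrite /trnorm -[RHS]sup1; congr sup.
apply/seteqP; split=> [r [Q [hQ QQ rE]]|r /= ->] /=; last first.
  by exists P; split=> //; rewrite rc_ReK.
have [d2 [W' hW' dW']] := pisom_dual hQ QQ.
have : \tr P <= \tr Q by rewrite -dW; apply: le_trans (real_ler_norm _) (d2 _ hW); rewrite dW ger0_real.
have Q0 : 0 <= \tr Q by apply: le_trans (d2 _ hW').
have : \tr Q <= \tr P by rewrite -dW'; apply: le_trans (real_ler_norm _) (d1 _ hW'); rewrite dW' ger0_real.
by move=> h1 h2; have /= <- := @le_anti _ _ (\tr Q) (\tr P); rewrite ?h1 ?h2 // -rE.
Qed.

Lemma trnorm_ub n (X W : 'M[C]_n) : pisom W -> `|\tr (W *m X)| <= rc (trnorm X).
Proof.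
have [P hP PP] := psd_sqrt (psd_adj_mul X).
by rewrite (trnormE hP PP) => hW; have [+ _] := pisom_dual hP PP; apply.
Qed.

Lemma trnorm_attained n (X : 'M[C]_n) :
  exists2 W : 'M[C]_n, pisom W & \tr (W *m X) = rc (trnorm X).
Proof.
have [P hP PP] := psd_sqrt (psd_adj_mul X).
by rewrite (trnormE hP PP); have [_] := pisom_dual hP PP.
Qed.

Lemma trnorm_ge0 n (X : 'M[C]_n) : 0 <= trnorm X.
Proof.
have [W hW _] := trnorm_attained X.
by rewrite -rc_ge0; apply: le_trans (trnorm_ub X hW).
Qed.

(** Take an optimal [W] for the sum and apply the triangle inequality. By cyclicity of the trace,
    conjugating [X] by [A k] amounts to conjugating [W] by its adjoint, which is again a partial
    isometry. *)
Lemma trnorm_mix (I : finType) n (c : I -> R) (A : I -> 'M[C]_n) (X : 'M[C]_n) :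
  (forall k, A k \is unitarymx) ->
  trnorm (\sum_k rc (c k) *: (A k *m X *m adjmx (A k)))
    <= (\sum_k `|c k|) * trnorm X.
Proof.
move=> AU; set Y := \sum_k _.
have [W hW WY] := trnorm_attained Y.
rewrite -lecR -[_%:C%C]/(rc (trnorm Y)) -WY.
have Yge0 : 0 <= \tr (W *m Y) by rewrite WY rc_ge0 trnorm_ge0.
rewrite -(ger0_norm Yge0) /Y mulmx_sumr raddf_sum /=.
apply: le_trans (ler_norm_sum _ _ _) _.
rewrite mulr_suml rmorph_sum /=; apply: ler_sum => k _.
rewrite -scalemxAr mxtraceZ normrM rmorphM /=.
have -> : `|rc (c k)| = (`|c k|)%:C%C by rewrite normc_def /= expr0n addr0 sqrtr_sqr.
rewrite ler_wpM2l ?ler0c //.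
rewrite !mulmxA mxtrace_mulC !mulmxA; apply: trnorm_ub.
by apply: pisom_mulu => //; apply: pisom_umul => //; apply: unitarymx_adjmx.
Qed.

End Adjoint.

(** * Diamond norms *)

Section Channels.
Variable R : realType.
Local Notation C := R[i].

Lemma hi_idx4 a b : hi (idx4 a b) = a.
Proof. by apply/val_inj; case: a b => [[|[|a]] //= ?] [[|[|b]] //= ?]; rewrite /hi /idx4 !inordK. Qed.

Lemma lo_idx4 a b : lo (idx4 a b) = b.
Proof. by apply/val_inj; case: a b => [[|[|a]] //= ?] [[|[|b]] //= ?]; rewrite /lo /idx4 !inordK. Qed.

Lemma sum4E (f : 'I_4 -> C) : \sum_i f i = \sum_a \sum_b f (idx4 a b).
Proof.
rewrite !big_ord_recl !big_ord0 !addr0 !addrA.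
by do ![congr (_ + _)]; congr f; apply/val_inj; rewrite /= /idx4 inordK.
Qed.

(* [1 (x) A]. *)
Definition kr (A : 'M[C]_2) : 'M[C]_4 :=
  \matrix_(i, j) ((hi i == hi j)%:R * A (lo i) (lo j)).

(* The vectorization [|A>>] of [A], in the index convention of [idx4]. *)
Definition dbl (A : 'M[C]_2) : 'cV[C]_4 := \col_i A (lo i) (hi i).

Lemma idtens_uch A X : idtens (uch A) X = kr A *m X *m adjmx (kr A).
Proof.
apply/matrixP => i j; rewrite [LHS]mxE /uch.
rewrite [LHS]mxE [RHS]mxE sum4E [RHS](bigD1 (hi j)) //= [X in _ = _ + X]big1 => [|a /negPf aj].
  rewrite addr0; apply: eq_bigr => b _.
  rewrite ![adjmx _ _ _]mxE [kr _ _ _]mxE hi_idx4 lo_idx4 eqxx mul1r; congr (_ * _).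
  rewrite [LHS]mxE [RHS]mxE sum4E [RHS](bigD1 (hi i)) //= [X in _ = _ + X]big1 => [|a /negPf ai].
    by rewrite addr0; apply: eq_bigr => c _; rewrite !mxE hi_idx4 lo_idx4 eqxx mul1r.
  by apply: big1 => c _; rewrite !mxE hi_idx4 eq_sym ai !mul0r.
apply: big1 => k _.
by rewrite ![adjmx _ _ _]mxE [kr _ _ _]mxE hi_idx4 eq_sym aj mul0r conjc0 mulr0.
Qed.

Lemma kr_dbl A B : kr A *m dbl B = dbl (A *m B).
Proof.
apply/matrixP => i j; rewrite [LHS]mxE sum4E [LHS](bigD1 (hi i)) //= [X in _ + X = _]big1 => [|a /negPf ai].
  rewrite addr0 !mxE; apply: eq_bigr => k _.
  by rewrite !mxE hi_idx4 lo_idx4 eqxx mul1r.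
by apply: big1 => k _; rewrite !mxE hi_idx4 eq_sym ai !mul0r.
Qed.

Lemma idx4K i : idx4 (hi i) (lo i) = i.
Proof.
by apply/val_inj; case: i => [[|[|[|[|i]]]] //= ?]; rewrite /idx4 /hi /lo /= !inordK ?inordK.
Qed.

Lemma krM A B : kr A *m kr B = kr (A *m B).
Proof.
apply/matrixP => i j.
rewrite mxE sum4E (bigD1 (hi i)) //= [X in _ + X]big1 => [|a /negPf ai]; last first.
  by apply: big1 => k _; rewrite !mxE hi_idx4 eq_sym ai !mul0r.
rewrite addr0 !mxE mulr_sumr; apply: eq_bigr => k _.
by rewrite !mxE hi_idx4 lo_idx4 eqxx mul1r mulrCA.
Qed.

Lemma kr1 : kr 1%:M = 1%:M.
Proof.
apply/matrixP => i j; rewrite !mxE -natrM mulnb; congr (_%:R); congr nat_of_bool.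
apply/andP/eqP => [[/eqP h /eqP l]|->]; last by rewrite !eqxx.
by rewrite -(idx4K i) h l idx4K.
Qed.

Lemma kr_adj A : kr (adjmx A) = adjmx (kr A).
Proof. by apply/matrixP => i j; rewrite !mxE rmorphM /= conjc_nat eq_sym. Qed.

Lemma kr_unitarymx A : A \is unitarymx -> kr A \is unitarymx.
Proof.
move=> /unitarymx_adj AU; apply/unitarymxP.
by rewrite -adjmxE -kr_adj krM AU kr1.
Qed.

Lemma omegaE : omega R = dbl 1%:M.
Proof. by apply/matrixP => i j; rewrite !mxE eq_sym; case: eqP. Qed.

Lemma dbl_dot A B : (adjmx (dbl A) *m dbl B) 0 0 = \tr (adjmx A *m B).
Proof.
rewrite mxE sum4E; apply: eq_bigr => a _; rewrite mxE; apply: eq_bigr => b _.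
by rewrite !mxE hi_idx4 lo_idx4.
Qed.

(* The state obtained from the maximally entangled one by [1 (x) A]. *)
Definition mes (A : 'M[C]_2) : 'M[C]_4 := 2^-1 *: (dbl A *m adjmx (dbl A)).

Lemma mes_adj A : adjmx (mes A) = mes A.
Proof. by rewrite /mes adjmxZ adjmxM adjmxK fmorphV rmorph_nat. Qed.

Lemma uch_mes A B : idtens (uch A) (mes B) = mes (A *m B).
Proof.
by rewrite idtens_uch /mes -scalemxAr -scalemxAl !mulmxA kr_dbl -mulmxA -adjmxM kr_dbl.
Qed.

Lemma choi_uch A : choi (uch A) = dbl A *m adjmx (dbl A).
Proof.
rewrite /choi omegaE idtens_uch !mulmxA kr_dbl -mulmxA -adjmxM kr_dbl.
by rewrite mulmx1.
Qed.

(** For unitary [A] and [B] this is the transition probability between the pure states [mes A] and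
    [mes B]. *)
Definition overlap (A B : 'M[C]_2) : C := `|\tr (adjmx A *m B) / 2| ^+ 2.

Lemma dbl_dotmx A B : adjmx (dbl A) *m dbl B = (\tr (adjmx A *m B))%:M.
Proof. by apply/matrixP => i j; rewrite !ord1 dbl_dot mxE mulr1n. Qed.

Lemma overlapE A B : overlap A B = \tr (adjmx A *m B) * \tr (adjmx B *m A) / 4.
Proof.
have -> : adjmx B *m A = adjmx (adjmx A *m B) by rewrite adjmxM adjmxK.
rewrite mxtrace_adj /overlap normCK rmorphM fmorphV rmorph_nat /=.
by rewrite mulrACA -invfM -natrM.
Qed.

Lemma dbl_mul3 (A B D E : 'M[C]_2) :
  dbl A *m adjmx (dbl B) *m (dbl D *m adjmx (dbl E))
    = \tr (adjmx B *m D) *: (dbl A *m adjmx (dbl E)).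
Proof.
rewrite !mulmxA -(mulmxA (dbl A)) dbl_dotmx.
by rewrite mul_mx_scalar -scalemxAl.
Qed.

Lemma mes_trM A B : \tr (mes A *m mes B) = overlap A B.
Proof.
rewrite /mes -scalemxAl -scalemxAr scalerA dbl_mul3 !mxtraceZ.
rewrite (mxtrace_mulC (dbl A)) dbl_dotmx mxtrace_scalar mulr1n overlapE.
by rewrite -invfM -natrM mulrC.
Qed.

Lemma mes_tr A : A \is unitarymx -> \tr (mes A) = 1.
Proof.
move=> AU; rewrite /mes mxtraceZ mxtrace_mulC dbl_dotmx mxtrace_scalar mulr1n.
by rewrite adj_unitarymx // mxtrace1 mulVf // pnatr_eq0.
Qed.

Lemma mes_mulM A B :
  mes A *m mes B = (\tr (adjmx A *m B) / 4) *: (dbl A *m adjmx (dbl B)).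
Proof.
rewrite /mes -scalemxAl -scalemxAr dbl_mul3 !scalerA; congr (_ *: _).
by field.
Qed.

Lemma mes_idem A : A \is unitarymx -> mes A *m mes A = mes A.
Proof.
move=> AU; rewrite mes_mulM adj_unitarymx // mxtrace1 /mes; congr (_ *: _).
by field.
Qed.

Lemma mes_mul3 A B : mes A *m mes B *m mes A = overlap A B *: mes A.
Proof.
rewrite /mes -!(scalemxAl, scalemxAr) !scalerA dbl_mul3 -scalemxAl dbl_mul3 !scalerA.
rewrite overlapE; congr (_ *: _).
by field.
Qed.

Lemma mes_psd A : A \is unitarymx -> psd (mes A).
Proof. by move=> AU; rewrite -mes_idem // -{1}mes_adj; apply: psd_adj_mul. Qed.

Lemma trnorm_mes A : A \is unitarymx -> trnorm (mes A) = 1.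
Proof.
move=> AU; apply: (@complexI R); rewrite -[LHS]/(rc _) (@trnormE _ _ (mes A)).
- exact: mes_tr.
- exact: mes_psd.
- by rewrite mes_adj.
Qed.

Lemma unitarymx1 n : (1%:M : 'M[C]_n) \is unitarymx.
Proof. by apply/unitarymxP; rewrite -adjmxE adjmx1 mulmx1. Qed.

(** * Diamond norm of real combinations of unitary channels *)

Section Mix.
Variables (I : finType) (c : I -> R) (A : I -> 'M[C]_2) (F : 'M[C]_2 -> 'M[C]_2).
Hypothesis AU : forall k, A k \is unitarymx.
Hypothesis FE : forall rho, F rho = \sum_k rc (c k) *: uch (A k) rho.

Lemma idtens_mix X : idtens F X = \sum_k rc (c k) *: idtens (uch (A k)) X.
Proof.
apply/matrixP => i j; rewrite mxE FE !summxE; apply: eq_bigr => k _.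
by rewrite !mxE.
Qed.

Lemma idtens_mix_ub X : trnorm (idtens F X) <= (\sum_k `|c k|) * trnorm X.
Proof.
rewrite idtens_mix; under eq_bigr do rewrite idtens_uch.
by apply: trnorm_mix => k; apply: kr_unitarymx.
Qed.

Lemma diamond_set_ub : ubound
  [set r : R | exists X : 'M[C]_4, trnorm X <= 1 /\ r = trnorm (idtens F X)]%classic
  (\sum_k `|c k|).
Proof.
move=> r /= [X [X1 ->]]; apply: le_trans (idtens_mix_ub X) _.
by rewrite ler_piMr // sumr_ge0.
Qed.

Lemma diamond_le : diamond F <= \sum_k `|c k|.
Proof.
apply: ge_sup; last exact: diamond_set_ub.
by exists (trnorm (idtens F (mes 1%:M))); exists (mes 1%:M); rewrite trnorm_mes ?unitarymx1.
Qed.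

(** The channel is tested on the maximally entangled state [mes 1%:M], of trace norm 1. Its output
    is the combination of the [mes (A k)], and any partial isometry bounds the trace norm of that
    output from below. *)
Lemma diamond_ge (W : 'M[C]_4) : pisom W ->
  `|\tr (W *m \sum_k rc (c k) *: mes (A k))| <= rc (diamond F).
Proof.
move=> hW.
have -> : \sum_k rc (c k) *: mes (A k) = idtens F (mes 1%:M).
  by rewrite idtens_mix; apply: eq_bigr => k _; rewrite uch_mes mulmx1.
apply: le_trans (trnorm_ub _ hW) _; rewrite lecR.
apply: ub_le_sup; first by exists (\sum_k `|c k|); apply: diamond_set_ub.
by exists (mes 1%:M); rewrite trnorm_mes ?unitarymx1.
Qed.
End Mix.

(* Otherwise unification unfolds [mes] down to matrix entries. *)
Local Opaque mes.

Lemma sqr_sub_idem n (a b : 'M[C]_n) : a *m a = a -> b *m b = b ->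
  (a - b) *m (a - b) = a + b - a *m b - b *m a.
Proof.
move=> aa bb; rewrite mulmxBl !mulmxBr aa bb.
move: (a *m b) (b *m a) => ab ba.
by apply/matrixP => i j; rewrite !mxE; ring.
Qed.

(** For rank-one projections with transition probability [g], the difference has eigenvalues among 0
    and the two square roots of [1 - g]. The cubic relation records this without diagonalization. *)
Lemma cube_sub_idem n (a b : 'M[C]_n) (g : C) : a *m a = a -> b *m b = b ->
  a *m b *m a = g *: a -> b *m a *m b = g *: b ->
  (a - b) *m (a - b) *m (a - b) = (1 - g) *: (a - b).
Proof.
move=> aa bb aba bab; rewrite (sqr_sub_idem aa bb).
rewrite mulmxBr !(mulmxDl, mulmxBl, mulNmx) aba bab aa bb.
rewrite -(mulmxA b a a) -(mulmxA a b b) aa bb.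
move: (a *m b) (b *m a) => ab ba.
by apply/matrixP => i j; rewrite !mxE; ring.
Qed.

Lemma reflection_sqr n (a : 'M[C]_n) : a *m a = a ->
  (2 *: a - 1%:M) *m (2 *: a - 1%:M) = 1%:M.
Proof.
move=> aa; rewrite mulmxBr mulmx1 mulmxBl mul1mx -!(scalemxAl, scalemxAr) aa.
by apply/matrixP => i j; rewrite !mxE; ring.
Qed.

(** The eigenvalues of [X] lie in [{0, s, -s}], so up to the sign of [s] the rescaled matrix is the
    sign of [X], an optimal test operator for its trace norm. *)
Lemma pisom_cube n (X : 'M[C]_n) (s : R) : s != 0 -> adjmx X = X ->
  X *m X *m X = (rc s * rc s) *: X -> pisom (rc s^-1 *: X).
Proof.
move=> s0 Xa X3; rewrite /pisom adjmxZ conj_rc Xa -!(scalemxAl, scalemxAr) X3 !scalerA.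
by rewrite -!rmorphM; congr (rc _ *: _); field.
Qed.

(** The trace distance of the pure states [mes A] and [mes B] is the square root of [1 - g], and the
    diamond distance dominates it. *)
Lemma diamond_unitary_sub (A B : 'M[C]_2) (g e : R) :
  A \is unitarymx -> B \is unitarymx -> overlap A B = rc g ->
  diamond (chsub (uch A) (uch B)) / 2 <= e -> 1 - g <= e ^+ 2.
Proof.
move=> AU BU gE; set D := diamond _ => De.
(* Splitting off the trivial case makes [s] positive, hence invertible. *)
have [g1|g1] := leP 1 g; first by apply: (@le_trans _ _ 0); rewrite ?sqr_ge0 // subr_le0.
pose c (b : bool) : R := if b then 1 else -1.
pose M (b : bool) := if b then A else B.
have MU b : M b \is unitarymx by case: b; [exact: AU | exact: BU].
have FE rho : chsub (uch A) (uch B) rho = \sum_b rc (c b) *: uch (M b) rho.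
  by rewrite big_bool /c /M /= scale1r rmorphN rmorph1 /= scaleN1r.
set s := Num.sqrt (1 - g).
have s0 : 0 < s by rewrite sqrtr_gt0 subr_gt0.
have sr0 : s != 0 by rewrite gt_eqF.
have s2 : rc s * rc s = 1 - overlap A B.
  rewrite gE -rmorphM -expr2 sqr_sqrtr ?subr_ge0 ?ltW //.
  by rewrite rmorphB rmorph1.
have sV : rc s^-1 * rc s = 1 by rewrite -rmorphM mulVf // rmorph1.
have [X XD] : exists X, X = mes A - mes B by exists (mes A - mes B).
have XE : \sum_b rc (c b) *: mes (M b) = X.
  by rewrite big_bool /c /M /= scale1r rmorphN rmorph1 /= scaleN1r XD.
have oC : overlap B A = overlap A B by rewrite !overlapE [X in X / _]mulrC.
have X2 : X *m X = mes A + mes B - mes A *m mes B - mes B *m mes A.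
  by rewrite XD; apply: sqr_sub_idem; [exact: (mes_idem AU) | exact: (mes_idem BU)].
have X3 : X *m X *m X = (rc s * rc s) *: X.
  rewrite s2 XD; apply: cube_sub_idem (mes_idem AU) (mes_idem BU) (mes_mul3 A B) _.
  by rewrite -oC; exact: mes_mul3.
have Xa : adjmx X = X by rewrite XD adjmxB !mes_adj.
have hW := pisom_cube sr0 Xa X3.
have := diamond_ge MU FE hW; rewrite XE.
have -> : \tr (rc s^-1 *: X *m X) = rc (2 * s).
  rewrite -scalemxAl mxtraceZ X2 !mxtraceB mxtraceD (mes_tr AU) (mes_tr BU) !mes_trM oC.
  rewrite rmorphM rmorph_nat.
  transitivity (rc s^-1 * (2 * (1 - overlap A B))); first by ring.
  by rewrite -s2 mulrCA; congr (_ * _); rewrite mulrA sV mul1r.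
rewrite ger0_norm ?rc_ge0 ?mulr_ge0 ?(ltW s0) // rc_le => h.
have se : s <= e by move: h De; rewrite -/D; lra.
have : s ^+ 2 <= e ^+ 2 by rewrite ler_pXn2r ?nnegrE ?(ltW s0) // (le_trans (ltW s0)).
by rewrite sqr_sqrtr // subr_ge0 ltW.
Qed.

Definition sig (k : 'I_4) : 'M[C]_2 := nth 1%:M [:: 1%:M; pX R; pY R; pZ R] k.

(** Pauli weights of the identity minus a depolarizing channel; the first one is
    [1 - (1 - 3 * q)]. *)
Definition depc (q : R) (k : 'I_4) : R := if k == 0 :> nat then 3 * q else - q.

Lemma adj_sig k : adjmx (sig k) = sig k.
Proof.
case: k => [[|[|[|[|k]]]] //= ?]; rewrite /sig /=; first exact: adjmx1;
 apply/matrixP => [[[|[|i]] //= ?] [[|[|j]] //= ?]]; rewrite !mxE /=;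
 by apply/eqP; rewrite eq_complex /= ?oppr0 ?opprK ?eqxx.
Qed.

Lemma sig_sqr k : sig k *m sig k = 1%:M.
Proof.
case: k => [[|[|[|[|k]]]] //= ?]; rewrite /sig /=; first exact: mulmx1;
 apply/matrixP => [[[|[|i]] //= ?] [[|[|j]] //= ?]];
 by rewrite !mxE !big_ord_recl !big_ord0 !mxE /= ?(mulr0,mul0r,mulr1,mul1r,addr0,add0r,mulrN,mulNr,opprK) -?expr2 ?sqr_i ?opprK.
Qed.

Lemma sig_unitarymx k : sig k \is unitarymx.
Proof. by apply/unitarymxP; rewrite -adjmxE adj_sig sig_sqr. Qed.

Lemma tr_sig k : \tr (sig k) = if k == 0 :> nat then 2 else 0.
Proof.
case: k => [[|[|[|[|k]]]] //= ?]; rewrite /sig /= ?mxtrace1 //;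
 by rewrite /mxtrace !big_ord_recl !big_ord0 !mxE /= ?(addr0,add0r,subrr).
Qed.

(** The sum of the absolute weights, [6 * q], is an upper bound. It is attained because the four
    states [mes (sig k *m A)] are mutually orthogonal, so that one test operator can match all the
    signs. *)
Lemma diamond_depolarizing_sub (A : 'M[C]_2) (q : R) (F : 'M[C]_2 -> 'M[C]_2) :
  A \is unitarymx -> 0 <= q ->
  (forall rho, F rho = \sum_k rc (depc q k) *: uch (sig k *m A) rho) ->
  diamond F = 6 * q.
Proof.
move=> AU q_ge0 FE.
have MU k : sig k *m A \is unitarymx by exact: mul_unitarymx (sig_unitarymx k) AU.
apply/eqP; rewrite eq_le; apply/andP; split.
  apply: le_trans (diamond_le MU FE) _.
  rewrite !big_ord_recl big_ord0 /depc /= !normrN !ger0_norm ?mulr_ge0 //; lra.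
(* This reflection has expectation 1 on [mes A] and -1 on the other three states, the signs of the
   weights [depc q k]. *)
set W := 2 *: mes A - 1%:M.
have Wa : adjmx W = W by rewrite /W adjmxB adjmxZ mes_adj adjmx1 rmorph_nat.
have hW : pisom W.
  have WW : W *m W = 1%:M := reflection_sqr (mes_idem AU).
  by rewrite /pisom Wa WW mul1mx.
have := diamond_ge MU FE hW.
have trW B : B \is unitarymx -> \tr (W *m mes B) = 2 * overlap A B - 1.
  by move=> BU; rewrite /W mulmxBl mul1mx -scalemxAl mxtraceB mxtraceZ mes_trM (mes_tr BU).
have ov k : overlap A (sig k *m A) = (k == 0 :> nat)%:R.
  rewrite /overlap mulmxA mxtrace_mulC mulmxA (unitarymx_adj AU) mul1mx tr_sig.
  by case: eqP => _; rewrite ?mul0r ?normr0 ?expr0n // divff ?pnatr_eq0 // normr1 expr1n.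
have -> : \tr (W *m \sum_k rc (depc q k) *: mes (sig k *m A)) = rc (6 * q).
  rewrite mulmx_sumr raddf_sum /=.
  rewrite (eq_bigr (fun k => rc (depc q k * (2 * (k == 0 :> nat)%:R - 1)))); last first.
    move=> k _; rewrite -scalemxAr mxtraceZ (trW _ (MU k)) ov.
    by rewrite rmorphM rmorphB rmorphM !rmorph_nat.
  rewrite -rmorph_sum; congr rc.
  by rewrite !big_ord_recl big_ord0 /depc /=; ring.
by rewrite ger0_norm ?rc_ge0 ?mulr_ge0 // rc_le.
Qed.

End Channels.

(** * Magic basis *)

Notation ord9_ k := (@Ordinal 9 k isT).
Notation ord4_0 := (@Ordinal 4 0 isT).
Notation ord4_1 := (@Ordinal 4 1 isT).
Notation ord4_2 := (@Ordinal 4 2 isT).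
Notation ord4_3 := (@Ordinal 4 3 isT).

Lemma eq_ord4 : ((ord4_0 == ord4_1 = false) * (ord4_0 == ord4_2 = false) * (ord4_0 == ord4_3 = false) *
  (ord4_1 == ord4_0 = false) * (ord4_1 == ord4_2 = false) * (ord4_1 == ord4_3 = false) *
  (ord4_2 == ord4_0 = false) * (ord4_2 == ord4_1 = false) * (ord4_2 == ord4_3 = false) *
  (ord4_3 == ord4_0 = false) * (ord4_3 == ord4_1 = false) * (ord4_3 == ord4_2 = false))%type.
Proof. by []. Qed.

Lemma ord4P (P : 'I_4 -> Prop) : P ord4_0 -> P ord4_1 -> P ord4_2 -> P ord4_3 -> forall a, P a.
Proof.
move=> h0 h1 h2 h3 [[|[|[|[|a]]]] //= lt4].
- by rewrite (_ : Ordinal _ = ord4_0) //; apply/val_inj.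
- by rewrite (_ : Ordinal _ = ord4_1) //; apply/val_inj.
- by rewrite (_ : Ordinal _ = ord4_2) //; apply/val_inj.
- by rewrite (_ : Ordinal _ = ord4_3) //; apply/val_inj.
Qed.

Lemma ord2P (P : 'I_2 -> Prop) : P 0 -> P 1 -> forall a, P a.
Proof.
move=> h0 h1 [[|[|a]] //= lt2].
- by rewrite (_ : Ordinal _ = 0) //; apply/val_inj.
- by rewrite (_ : Ordinal _ = 1) //; apply/val_inj.
Qed.

Lemma sum_ord2 (V : nmodType) (f : 'I_2 -> V) : \sum_i f i = f 0 + f 1.
Proof.
rewrite !big_ord_recl big_ord0 addr0; congr (_ + f _).
exact/val_inj.
Qed.

Lemma sum_ord4 (V : nmodType) (f : 'I_4 -> V) : \sum_i f i = f ord4_0 + f ord4_1 + f ord4_2 + f ord4_3.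
Proof.
rewrite !big_ord_recl big_ord0 addr0 !addrA.
by do ![congr (_ + _)]; congr f; apply/val_inj.
Qed.

Section Magic.
Variable R : realType.
Local Notation C := R[i].

Lemma conjN (x : C) : Num.conj (- x) = - Num.conj x. Proof. exact: rmorphN. Qed.
Lemma conjD (x y : C) : Num.conj (x + y) = Num.conj x + Num.conj y. Proof. exact: rmorphD. Qed.
Lemma conjM (x y : C) : Num.conj (x * y) = Num.conj x * Num.conj y. Proof. exact: rmorphM. Qed.
Lemma conj0 : Num.conj (0 : C) = 0. Proof. exact: rmorph0. Qed.
Lemma conj1 : Num.conj (1 : C) = 1. Proof. exact: rmorph1. Qed.
Lemma conj2V : Num.conj (2^-1 : C) = 2^-1. Proof. by rewrite fmorphV rmorph_nat. Qed.

(* Locked: [/=] would otherwise compute [- ii] componentwise. *)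
Definition ii : C := locked (Complex 0 1).

Lemma iiE : Complex 0 1 = ii. Proof. by rewrite /ii -lock. Qed.

Lemma ii_sqr : ii * ii = -1. Proof. by rewrite -iiE -expr2 sqr_i. Qed.

Lemma conj_ii : Num.conj ii = - ii.
Proof. by rewrite -iiE; apply/eqP; rewrite eq_complex /= oppr0 !eqxx. Qed.

Lemma mx2P (A B : 'M[C]_2) :
  A 0 0 = B 0 0 -> A 0 1 = B 0 1 -> A 1 0 = B 1 0 -> A 1 1 = B 1 1 -> A = B.
Proof.
by move=> h00 h01 h10 h11; apply/matrixP; apply: ord2P; apply: ord2P.
Qed.

Lemma pXE : (pX R 0 0 = 0) * (pX R 0 1 = 1) * (pX R 1 0 = 1) * (pX R 1 1 = 0).
Proof. by rewrite !mxE. Qed.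

Lemma pYE : (pY R 0 0 = 0) * (pY R 0 1 = - ii) * (pY R 1 0 = ii) * (pY R 1 1 = 0).
Proof. by rewrite -iiE !mxE. Qed.

Lemma pZE : (pZ R 0 0 = 1) * (pZ R 0 1 = 0) * (pZ R 1 0 = 0) * (pZ R 1 1 = -1).
Proof. by rewrite !mxE. Qed.

Lemma mx1E : ((1%:M : 'M[C]_2) 0 0 = 1) * ((1%:M : 'M[C]_2) 0 1 = 0)
   * ((1%:M : 'M[C]_2) 1 0 = 0) * ((1%:M : 'M[C]_2) 1 1 = 1).
Proof. by rewrite !mxE. Qed.

(* The coordinates of [|V>> / sqrt 2] in the magic basis, so that
   [V = mag 0 + i mag 1 Z + i mag 2 X - i mag 3 Y]. *)
Definition mag (V : 'M[C]_2) (a : 'I_4) : C :=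
  match nat_of_ord a with
  | 0%N => (V 0 0 + V 1 1) / 2
  | 1%N => - ii * (V 0 0 - V 1 1) / 2
  | 2%N => - ii * (V 1 0 + V 0 1) / 2
  | _ => (V 1 0 - V 0 1) / 2
  end.

Definition magq (a : 'I_4) : 'M[C]_2 :=
  match nat_of_ord a with
  | 0%N => 1%:M
  | 1%N => ii *: pZ R
  | 2%N => ii *: pX R
  | _ => - ii *: pY R
  end.

Lemma mag_expand V : V = \sum_a mag V a *: magq a.
Proof.
rewrite sum_ord4 /mag /magq; cbn [nat_of_ord].
have mxED (A B : 'M[C]_2) i j : (A + B) i j = A i j + B i j by rewrite mxE.
have mxEZ (a : C) (B : 'M[C]_2) i j : (a *: B) i j = a * B i j by rewrite mxE.
by apply: mx2P; rewrite !(mxED, mxEZ) ?pXE ?pYE ?pZE ?mx1E; field: ii_sqr.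
Qed.

Lemma s2_sqr : s2 R * s2 R = 2^-1.
Proof.
rewrite /s2 -rmorphM -invfM -expr2 sqr_sqrtr ?ler0n //.
by rewrite fmorphV rmorph_nat.
Qed.

Lemma conj_s2 : Num.conj (s2 R) = s2 R.
Proof. exact: conj_rc. Qed.

Lemma magic_tblE : magic_tbl R = [:: [:: s2 R; 0; 0; s2 R];
  [:: ii * s2 R; 0; 0; - (ii * s2 R)]; [:: 0; ii * s2 R; ii * s2 R; 0]; [:: 0; s2 R; - s2 R; 0]].
Proof. by rewrite /ii -lock. Qed.

(** The factor [2 * s2] is the square root of 2, the norm of [|V>>] for unitary [V]. *)
Lemma psi_dbl V a : (adjmx (psi R a) *m dbl V) 0 0 = 2 * s2 R * mag V a.
Proof.
have h00 : nat_of_ord (idx4 0 0) = 0%N by rewrite /idx4 inordK.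
have h01 : nat_of_ord (idx4 0 1) = 1%N by rewrite /idx4 inordK.
have h10 : nat_of_ord (idx4 1 0) = 2%N by rewrite /idx4 inordK.
have h11 : nat_of_ord (idx4 1 1) = 3%N by rewrite /idx4 inordK.
have dE a' b : dbl V (idx4 a' b) 0 = V b a' by rewrite mxE hi_idx4 lo_idx4.
have pE k : adjmx (psi R a) 0 k = Num.conj (nth 0 (nth [::] (magic_tbl R) a) k) by rewrite !mxE.
rewrite mxE sum4E !sum_ord2 !pE !dE h00 h01 h10 h11 magic_tblE.
move: a {pE}; apply: ord4P; rewrite /mag; cbn [nat_of_ord nth];
  by rewrite !(conjN, conjM, conj0) ?conj_ii ?conj_s2; move: (s2 R) => s; field.
Qed.

Lemma mb_choi_uch V :
  rc (1 / 2) *: mb (choi (uch V)) = \matrix_(a, b) (mag V a * Num.conj (mag V b)).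
Proof.
apply/matrixP => a b; rewrite choi_uch [LHS]mxE [RHS]mxE.
have -> : mb (dbl V *m adjmx (dbl V)) a b
  = (adjmx (psi R a) *m (dbl V *m adjmx (dbl V)) *m psi R b) 0 0 by rewrite mxE.
rewrite mulmxA -mulmxA.
have -> : adjmx (dbl V) *m psi R b = adjmx (adjmx (psi R b) *m dbl V).
  by rewrite adjmxM adjmxK.
rewrite mxE big_ord1 psi_dbl [adjmx _ _ _]mxE -[_^*%C]/(Num.conj _) psi_dbl.
rewrite !conjM conj_s2 (rmorph_nat (@Num.conj C)) mul1r fmorphV rmorph_nat.
move: (s2 R) s2_sqr => s ss; transitivity (2 * (s * s) * (mag V a * Num.conj (mag V b))); first by field.
by rewrite ss; field.
Qed.

Lemma mag_parseval (A B : 'M[C]_2) :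
  \sum_a Num.conj (mag A a) * mag B a = \tr (adjmx A *m B) / 2.
Proof.
rewrite sum_ord4 /mxtrace sum_ord2 !mxE !sum_ord2 !mxE /mag; cbn [nat_of_ord].
rewrite !(conjM, conjN, conjD) conj_ii conj2V.
rewrite -![_^*%C]/(Num.conj _).
by field: ii_sqr.
Qed.

(** Here [d] is the determinant: the inverse of [V] is both its adjoint and its adjugate divided by
    [d]. *)
Lemma adj_det2 (V : 'M[C]_2) : V \is unitarymx ->
  exists2 d : C, `|d| = 1 &
   [/\ Num.conj (V 0 0) * d = V 1 1, Num.conj (V 0 1) * d = - V 1 0,
       Num.conj (V 1 0) * d = - V 0 1 & Num.conj (V 1 1) * d = V 0 0].
Proof.
move=> VU; have /matrixP VV := adj_unitarymx VU.
have E (i j : 'I_2) : Num.conj (V 0 i) * V 0 j + Num.conj (V 1 i) * V 1 j = (i == j)%:R.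
  by have := VV i j; rewrite !mxE sum_ord2 !mxE.
have := E 1 1; have := E 1 0; have := E 0 1; have := E 0 0.
move: (V 0 0) (V 0 1) (V 1 0) (V 1 1) {E VV} => x y z w e00 e01 e10 e11.
have {}e00 : Num.conj x * x + Num.conj z * z = 1 := e00.
have {}e01 : Num.conj x * y + Num.conj z * w = 0 := e01.
have {}e10 : Num.conj y * x + Num.conj w * z = 0 := e10.
have {}e11 : Num.conj y * y + Num.conj w * w = 1 := e11.
pose d := x * w - y * z.
have h00 : Num.conj x * d = w.
  rewrite -[RHS]mul1r -e00 -[RHS](subr0) -[X in _ - X](mul0r z) -e01 /d; ring.
have h01 : Num.conj y * d = - z.
  rewrite -[z in RHS]mul1r -e11 -[RHS]addr0 -[X in _ + X](mul0r w) -e10 /d; ring.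
have h10 : Num.conj z * d = - y.
  rewrite -[y in RHS]mul1r -e00 -[RHS]addr0 -[X in _ + X](mul0r x) -e01 /d; ring.
have h11 : Num.conj w * d = x.
  rewrite -[RHS]mul1r -e11 -[RHS]subr0 -[X in _ - X](mul0r y) -e10 /d; ring.
exists d; last by split.
apply/eqP; rewrite -sqrp_eq1 // normCK mulrC; apply/eqP.
transitivity (Num.conj w * (Num.conj x * d) - Num.conj y * (Num.conj z * d)).
  by rewrite {1}/d conjD conjN !conjM; ring.
by rewrite h00 h10 -e11; ring.
Qed.

(** Says that the coordinates of [V] equal [r] up to a common phase. Products with conjugates hide
    the phase, so [r] is determined only up to sign. *)
Definition mag_real (V : 'M[C]_2) (r : 'I_4 -> R) :=
  forall a b, mag V a * Num.conj (mag V b) = rc (r a * r b).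

(** Conjugating a coordinate and multiplying by the determinant returns that coordinate. Multiplying
    by the conjugate of a square root of the determinant therefore makes all coordinates real, and
    Parseval gives the norm. *)
Lemma unitary_mag_real (V : 'M[C]_2) : V \is unitarymx ->
  exists r, mag_real V r /\ \sum_a r a ^+ 2 = 1.
Proof.
move=> VU; have [d d1 [h00 h01 h10 h11]] := adj_det2 VU.
have hm a : Num.conj (mag V a) * d = mag V a.
  move: a; apply: ord4P; rewrite /mag; cbn [nat_of_ord];
    rewrite !(conjM, conjN, conjD) ?conj_ii conj2V.
  - by rewrite mulrAC mulrDl h00 h11 addrC.
  - transitivity (ii * (Num.conj (V 0 0) * d - Num.conj (V 1 1) * d) / 2); first by ring.
    by rewrite h00 h11; ring.
  - transitivity (ii * (Num.conj (V 1 0) * d + Num.conj (V 0 1) * d) / 2); first by ring.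
    by rewrite h01 h10; ring.
  - by rewrite mulrAC mulrBl h01 h10 opprK addrC.
pose s := sqrtc d.
have ss : s * s = d by rewrite -expr2 sqr_sqrtc.
have s1 : `|s| = 1 by apply/eqP; rewrite -sqrp_eq1 // -normrX expr2 ss d1.
have sC : s * Num.conj s = 1 by rewrite -normCK s1 expr1n.
have sR a : mag V a * Num.conj s = Num.conj (mag V a) * s.
  by rewrite -{1}hm -ss -!mulrA sC mulr1.
pose r a := complex.Re (mag V a * Num.conj s).
have rE a : rc (r a) = mag V a * Num.conj s.
  by apply: RRe_real; apply/CrealP; rewrite conjM conjCK sR.
have rE' a : rc (r a) = Num.conj (mag V a) * s by rewrite rE sR.
have rr : mag_real V r.
  move=> a b; rewrite rmorphM /= [rc (r a)]rE [rc (r b)]rE'.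
  by rewrite mulrACA [Num.conj s * s]mulrC sC mulr1.
exists r; split => //; apply: (@complexI R); rewrite -[LHS]/(rc _) rmorph_sum rmorph1 /=.
transitivity (\tr (adjmx V *m V) / 2); last first.
  by rewrite adj_unitarymx // mxtrace1 divff // pnatr_eq0.
rewrite -mag_parseval; apply: eq_bigr => a _.
by rewrite expr2 -rr mulrC.
Qed.

Lemma overlap_mag (A B : 'M[C]_2) (rA rB : 'I_4 -> R) :
  mag_real A rA -> mag_real B rB ->
  overlap A B = rc ((\sum_a rA a * rB a) ^+ 2).
Proof.
move=> hA hB; rewrite /overlap -mag_parseval normCK.
rewrite rmorph_sum /= !big_distrlr expr2 big_distrlr rmorph_sum /=.
apply: eq_bigr => a _; rewrite rmorph_sum /=; apply: eq_bigr => b _.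
rewrite conjM conjCK mulrACA [_ * mag A b]mulrC hA hB -rmorphM; congr rc; ring.
Qed.

Lemma mb_choi_mix (I : finType) (c : I -> R) (A : I -> 'M[C]_2) F :
  (forall rho, F rho = \sum_k rc (c k) *: uch (A k) rho) ->
  rc (1 / 2) *: mb (choi F) =
    \matrix_(a, b) \sum_k rc (c k) * (mag (A k) a * Num.conj (mag (A k) b)).
Proof.
move=> FE; rewrite /choi (idtens_mix FE).
have -> : mb (\sum_k rc (c k) *: idtens (uch (A k)) (omega R *m adjmx (omega R)))
    = \sum_k rc (c k) *: mb (choi (uch (A k))).
  apply/matrixP => a b; rewrite mxE mulmx_sumr mulmx_suml !summxE.
  by apply: eq_bigr => k _; rewrite -scalemxAr -scalemxAl !mxE.
apply/matrixP => a b; rewrite scaler_sumr summxE mxE; apply: eq_bigr => k _.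
rewrite scalerA mulrC -scalerA mb_choi_uch [LHS]mxE; congr (_ * _).
by rewrite mxE.
Qed.

Lemma mag_sig : [/\ forall a, mag (sig R ord4_0) a = (a == ord4_0)%:R,
  forall a, mag (sig R ord4_1) a = - ii * (a == ord4_2)%:R,
  forall a, mag (sig R ord4_2) a = ii * (a == ord4_3)%:R &
  forall a, mag (sig R ord4_3) a = - ii * (a == ord4_1)%:R].
Proof.
split; apply: ord4P; rewrite /sig /mag; cbn [nat_of_ord nth];
  rewrite ?(mx1E, pXE, pYE, pZE) ?(eqxx, eq_ord4) ?mulr1n ?mulr0n; by field.
Qed.

(** Both the Pauli weights of a depolarizing channel and the diagonal of its half Choi matrix in the
    magic basis. The two orderings of the Paulis differ, but only among the three equal weights. *)
Definition depk (q : R) (a : 'I_4) : R := if a == ord4_0 then 1 - 3 * q else q.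

Lemma mb_choi_depolarizing (q : R) F :
  (forall rho, F rho = rc (1 - 3 * q) *: rho
      + rc q *: (pX R *m rho *m pX R + pY R *m rho *m pY R + pZ R *m rho *m pZ R)) ->
  rc (1 / 2) *: mb (choi F) = \matrix_(a, b) rc (depk q a * (a == b)%:R).
Proof.
move=> FE.
have FE' rho : F rho = \sum_k rc (depk q k) *: uch (sig R k) rho.
  rewrite FE sum_ord4 /uch !adj_sig /sig; cbn [nat_of_ord nth].
  by rewrite mul1mx mulmx1 !scalerDr !addrA.
rewrite (mb_choi_mix FE'); apply/matrixP => a b; rewrite mxE [RHS]mxE sum_ord4.
have [m0 m1 m2 m3] := mag_sig; rewrite !(m0, m1, m2, m3) !conjM !conjN conj_ii.
move: a b; apply: ord4P; apply: ord4P; rewrite !(eqxx, eq_ord4) ?(conj0, conj1);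
  by rewrite ?(mulr0, mul0r, mulr1, mulNr, mulrN, opprK, ii_sqr, addr0, add0r, rmorph0, oppr0).
Qed.

Lemma uch_mag V rho : uch V rho =
  \sum_a \sum_b (mag V a * Num.conj (mag V b)) *: (magq a *m rho *m adjmx (magq b)).
Proof.
rewrite /uch {1 2}(mag_expand V) mulmx_suml mulmx_suml; apply: eq_bigr => a _.
have -> : adjmx (\sum_b mag V b *: magq b) = \sum_b Num.conj (mag V b) *: adjmx (magq b).
  apply/matrixP => i j; rewrite mxE !summxE rmorph_sum; apply: eq_bigr => b _.
  by rewrite -adjmxZ [RHS]mxE.
rewrite mulmx_sumr; apply: eq_bigr => b _.
by rewrite -scalemxAl -scalemxAr -scalemxAl scalerA mulrC.
Qed.

(** In the expansion over pairs of [magq], the mixture has coefficient matrix [sum_k p_k r_k r_k^T].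
    When it is diagonal only Pauli conjugations remain, and the phases in [magq] cancel. *)
Lemma depolarizing_mix (I : finType) (p : I -> R) (V : I -> 'M[C]_2)
    (r : I -> 'I_4 -> R) (q : R) :
  (forall k, mag_real (V k) (r k)) ->
  (forall a b, \sum_k p k * (r k a * r k b) = depk q a * (a == b)%:R) ->
  forall rho, \sum_k rc (p k) *: uch (V k) rho = rc (1 - 3 * q) *: rho
      + rc q *: (pX R *m rho *m pX R + pY R *m rho *m pY R + pZ R *m rho *m pZ R).
Proof.
move=> Vr prE rho.
transitivity (\sum_a \sum_b rc (depk q a * (a == b)%:R) *: (magq a *m rho *m adjmx (magq b))).
  under eq_bigr do rewrite uch_mag scaler_sumr.
  rewrite exchange_big; apply: eq_bigr => a _.
  under eq_bigr do rewrite scaler_sumr.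
  rewrite exchange_big; apply: eq_bigr => b _.
  rewrite -prE rmorph_sum scaler_suml; apply: eq_bigr => k _.
  by rewrite scalerA (Vr k) -rmorphM.
have E a : \sum_b rc (depk q a * (a == b)%:R) *: (magq a *m rho *m adjmx (magq b))
    = rc (depk q a) *: (magq a *m rho *m adjmx (magq a)).
  rewrite (bigD1 a) //= big1 => [|b /negPf ab]; first by rewrite eqxx mulr1 addr0.
  by rewrite eq_sym ab mulr0 rmorph0 scale0r.
under eq_bigr do rewrite E.
have aX : adjmx (pX R) = pX R := adj_sig R ord4_1.
have aY : adjmx (pY R) = pY R := adj_sig R ord4_2.
have aZ : adjmx (pZ R) = pZ R := adj_sig R ord4_3.
rewrite sum_ord4 /magq /depk !(eqxx, eq_ord4); cbn [nat_of_ord].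
rewrite !adjmxZ adjmx1 mul1mx mulmx1 aX aY aZ !conjN conj_ii.
have sandwich (a b : C) (P : 'M[C]_2) :
    a *: P *m rho *m (b *: P) = (a * b) *: (P *m rho *m P).
  by rewrite -scalemxAr -scalemxAl -scalemxAl scalerA mulrC.
rewrite !sandwich !(mulNr, mulrN) ii_sqr !opprK !scale1r.
move: (pX R *m _ *m _) (pY R *m _ *m _) (pZ R *m _ *m _) => x y z.
by rewrite !scalerDr -!addrA [rc q *: z + _]addrC -!addrA.
Qed.

(** The converse compares the entries of the two Choi matrices in the magic basis. *)
Lemma mag_sum_of_depolarizing (I : finType) (p : I -> R) (V : I -> 'M[C]_2)
    (r : I -> 'I_4 -> R) (q : R) :
  (forall k, mag_real (V k) (r k)) ->
  (forall rho, \sum_k rc (p k) *: uch (V k) rho = rc (1 - 3 * q) *: rho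
      + rc q *: (pX R *m rho *m pX R + pY R *m rho *m pY R + pZ R *m rho *m pZ R)) ->
  forall a b, \sum_k p k * (r k a * r k b) = depk q a * (a == b)%:R.
Proof.
move=> Vr FE a b; apply: (@complexI R).
have := @mb_choi_mix _ p V (fun rho => \sum_k rc (p k) *: uch (V k) rho) (fun=> erefl).
rewrite (mb_choi_depolarizing FE) => /matrixP/(_ a b); rewrite !mxE => E.
rewrite -[RHS]/(rc _) -[LHS]/(rc _) E rmorph_sum; apply: eq_bigr => k _.
by rewrite rmorphM (Vr k).
Qed.

End Magic.

(** * Perturbation of the linear system *)

Section Perturbation.
Variable R : realType.

Lemma unitmx_inj n (M : 'M[R]_n) :
  (forall x : 'cV_n, M *m x = 0 -> x = 0) -> M \in unitmx.
Proof.
move=> inj; rewrite -unitmx_tr -row_free_unit; apply: inj_row_free => v.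
move/(congr1 trmx); rewrite trmx_mul trmxK trmx0 => /inj /(congr1 trmx).
by rewrite trmxK trmx0.
Qed.

(** Multiplying by [G = M0^-1] turns [M] into [1 + G (M - M0)], whose second term at most halves the
    l1 norm. This gives injectivity, an a priori bound on [x], and closeness of [x] to [p0]. *)
Lemma perturbed_solution n (M0 : 'M[R]_n) (p0 : 'cV[R]_n) (m : R) :
  M0 \in unitmx -> 0 < m -> (forall i, m <= p0 i 0) ->
  exists2 del : R, 0 < del & forall M : 'M[R]_n,
    (forall i j, `|M i j - M0 i j| <= del) ->
    M \in unitmx /\ forall x, M *m x = M0 *m p0 -> forall i, 0 < x i 0.
Proof.
move=> M0U m0 p0m; set G := invmx M0.
pose K : R := 1 + \sum_i \sum_j `|G i j|.
pose S : R := 1 + \sum_i `|p0 i 0|.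
have K1 : 1 <= K by rewrite lerDl !sumr_ge0 // => i _; rewrite sumr_ge0.
have S1 : 1 <= S by rewrite lerDl sumr_ge0.
pose N : R := n%:R + 1.
have N1 : 1 <= N by rewrite lerDr ler0n.
(* The first bound yields the factor 1/2 in l1 norm; the second keeps each coordinate of the
   solution within [m / 2] of [p0]. *)
pose tau : R := Num.min (2 * N)^-1 (m / (4 * S)).
have tau0 : 0 < tau.
  by rewrite lt_min invr_gt0 divr_gt0 ?mulr_gt0 //; lra.
have tauN : tau * N <= 2^-1.
  have : tau <= (2 * N)^-1 by rewrite ge_min lexx.
  have N0 : 0 < N by lra.
  rewrite -(ler_pM2r N0) => h; apply: le_trans h _.
  by rewrite invfM -mulrA mulVf ?mulr1 // gt_eqF.
have tauS : tau * (4 * S) <= m.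
  have : tau <= m / (4 * S) by rewrite ge_min lexx orbT.
  by rewrite ler_pdivlMr //; lra.
exists (tau / K); first by rewrite divr_gt0 //; lra.
move=> M Md.
have small (x : 'cV[R]_n) i : `|(G *m (M - M0) *m x) i 0| <= tau * \sum_k `|x k 0|.
  rewrite mxE mulr_sumr; apply: le_trans (ler_norm_sum _ _ _) _; apply: ler_sum => k _.
  rewrite normrM ler_wpM2r //.
  rewrite mxE; apply: le_trans (ler_norm_sum _ _ _) _.
  apply: (@le_trans _ _ (\sum_j `|G i j| * (tau / K))).
    by apply: ler_sum => j _; rewrite normrM ler_wpM2l // !mxE.
  rewrite -mulr_suml mulrCA ler_piMr ?(ltW tau0) //.
  rewrite ler_pdivrMr ?mul1r; last by lra.
  rewrite /K [X in 1 + X](bigD1 i) //=.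
  have : 0 <= \sum_(i0 < n | i0 != i) \sum_j `|G i0 j|.
    by apply: sumr_ge0 => i0 _; apply: sumr_ge0.
  lra.
have split_M (x : 'cV[R]_n) : G *m (M *m x) = x + G *m (M - M0) *m x.
  by rewrite mulmxBr mulmxBl !mulmxA mulVmx // mul1mx addrC subrK.
have sum_small (x : 'cV[R]_n) : \sum_i `|(G *m (M - M0) *m x) i 0| <= 2^-1 * \sum_k `|x k 0|.
  apply: (@le_trans _ _ (\sum_(i < n) (tau * \sum_k `|x k 0|))); first exact: ler_sum.
  rewrite sumr_const card_ord -[X in X <= _]mulr_natl mulrA ler_wpM2r ?sumr_ge0 //.
  by apply: le_trans tauN; rewrite mulrC ler_wpM2l ?ltW // /N; lra.
have norm_bound (x y : 'cV[R]_n) : G *m (M *m x) = y ->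
    \sum_k `|x k 0| <= 2 * \sum_k `|y k 0|.
  move=> xy; have xE : x = y - G *m (M - M0) *m x by rewrite -xy split_M addrK.
  have : \sum_k `|x k 0| <= \sum_k `|y k 0| + \sum_k `|(G *m (M - M0) *m x) k 0|.
    rewrite -big_split /=; apply: ler_sum => k _.
    have -> : x k 0 = y k 0 - (G *m (M - M0) *m x) k 0 by rewrite {1}xE !mxE.
    exact: ler_normB.
  have := sum_small x; lra.
split.
  apply: unitmx_inj => x Mx0.
  have := @norm_bound x 0; rewrite Mx0 mulmx0 => /(_ erefl).
  rewrite (_ : \sum_k `|(0 : 'cV[R]_n) k 0| = 0); last first.
    by apply: big1 => k _; rewrite mxE normr0.
  rewrite mulr0 => le0.
  have /eqP : \sum_k `|x k 0| = 0 by apply/le_anti; rewrite le0 sumr_ge0.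
  rewrite psumr_eq0 // => /allP h; apply/matrixP => i j.
  by rewrite mxE ord1; apply/eqP; rewrite -normr_eq0; apply: h; rewrite mem_index_enum.
move=> x Mx i.
have xp : G *m (M *m x) = p0 by rewrite Mx mulmxA mulVmx // mul1mx.
have xS : \sum_k `|x k 0| <= 2 * S by apply: le_trans (norm_bound _ _ xp) _; rewrite /S; lra.
have := small x i.
have -> : (G *m (M - M0) *m x) i 0 = p0 i 0 - x i 0.
  by rewrite -xp [in RHS]split_M [in RHS]mxE [RHS]addrC addKr.
move=> h; have h2 : `|p0 i 0 - x i 0| <= tau * (2 * S).
  by apply: le_trans h _; rewrite ler_wpM2l // ltW.
have := ler_norm (p0 i 0 - x i 0); have := p0m i; nra.
Qed.

(* Three orbits of the cyclic permutation of coordinates.  Weights constant on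
   orbits make [sum v v^T] invariant, so only [sum v] and the off-diagonal entry
   have to be balanced: this gives 1/12, 1/12 and 1/6. *)
Definition vtbl : seq (seq R) :=
  [:: [:: - (1/3); - (2/3); - (2/3)]; [:: - (2/3); - (1/3); - (2/3)];
      [:: - (2/3); - (2/3); - (1/3)];
      [:: 1; 0; 0]; [:: 0; 1; 0]; [:: 0; 0; 1];
      [:: 1/3; 2/3; - (2/3)]; [:: - (2/3); 1/3; 2/3]; [:: 2/3; - (2/3); 1/3]].

Definition vdir (j : 'I_9) (k : 'I_3) : R := nth 0 (nth [::] vtbl j) k.

Definition ord3_0 : 'I_3 := @Ordinal 3 0 isT.
Definition ord3_1 : 'I_3 := @Ordinal 3 1 isT.
Definition ord3_2 : 'I_3 := @Ordinal 3 2 isT.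

(* The equations depend on [p] only through [sum_j p_j r_j r_j^T]: rows 0-2 are
   its first row, rows 3-7 say that its lower right block is scalar, and row 8
   is normalization.  [a] and [u] stand for [a_j] and [w_j / (c eps)]. *)
Definition dep_eqn (i : 'I_9) (a : R) (u : 'I_3 -> R) : R :=
  match nat_of_ord i with
  | 0 => a * u ord3_0 | 1 => a * u ord3_1 | 2 => a * u ord3_2
  | 3 => u ord3_0 * u ord3_1 | 4 => u ord3_0 * u ord3_2 | 5 => u ord3_1 * u ord3_2
  | 6 => u ord3_0 * u ord3_0 - u ord3_1 * u ord3_1 | 7 => u ord3_0 * u ord3_0 - u ord3_2 * u ord3_2
  | _ => 1
  end.

Definition sys (a : 'I_9 -> R) (u : 'I_9 -> 'I_3 -> R) : 'M[R]_9 :=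
  \matrix_(i, j) dep_eqn i (a j) (u j).

Definition wt (j : 'I_9) : R := if (j < 6)%N then 1/12 else 1/6.

Lemma sum_ord9 (f : 'I_9 -> R) : \sum_i f i =
  f (ord9_ 0) + f (ord9_ 1) + f (ord9_ 2) + f (ord9_ 3) + f (ord9_ 4) + f (ord9_ 5) + f (ord9_ 6) + f (ord9_ 7) + f (ord9_ 8).
Proof.
rewrite !big_ord_recl big_ord0 addr0 !addrA.
by do ![congr (_ + _)]; congr f; apply/val_inj.
Qed.

Lemma ord9P (P : 'I_9 -> Prop) : P (ord9_ 0) -> P (ord9_ 1) -> P (ord9_ 2) -> P (ord9_ 3) ->
  P (ord9_ 4) -> P (ord9_ 5) -> P (ord9_ 6) -> P (ord9_ 7) -> P (ord9_ 8) -> forall a, P a.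
Proof.
move=> h0 h1 h2 h3 h4 h5 h6 h7 h8 [m lt9].
have E k (lt : (k < 9)%N) : P (Ordinal lt) -> m = k -> P (Ordinal lt9).
  by move=> + mk; rewrite (_ : Ordinal lt9 = Ordinal lt) //; apply/val_inj.
by move: m lt9 E => [|[|[|[|[|[|[|[|[|m]]]]]]]]] //= lt9 E;
  [exact: (E _ _ h0 erefl) | exact: (E _ _ h1 erefl) | exact: (E _ _ h2 erefl) | exact: (E _ _ h3 erefl) | exact: (E _ _ h4 erefl) |
   exact: (E _ _ h5 erefl) | exact: (E _ _ h6 erefl) | exact: (E _ _ h7 erefl) | exact: (E _ _ h8 erefl)].
Qed.

Lemma sum_ord3 (f : 'I_3 -> R) : \sum_i f i = f ord3_0 + f ord3_1 + f ord3_2.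
Proof.
rewrite !big_ord_recl big_ord0 addr0 !addrA.
by do ![congr (_ + _)]; congr f; apply/val_inj.
Qed.

Lemma vdir_unit j : \sum_(k < 3) vdir j k ^+ 2 = 1.
Proof.
by rewrite sum_ord3; move: j; apply: ord9P; rewrite /vdir /vtbl; cbn [nat_of_ord nth ord3_0 ord3_1 ord3_2]; field.
Qed.

Lemma sysE a u (p : 'cV[R]_9) i : (sys a u *m p) i 0 = \sum_j dep_eqn i (a j) (u j) * p j 0.
Proof. by rewrite mxE; apply: eq_bigr => j _; rewrite mxE. Qed.

Lemma sys0_unit : sys (fun=> 1) vdir \in unitmx.
Proof.
apply: unitmx_inj => x Mx0.
have E i : \sum_j dep_eqn i 1 (vdir j) * x j 0 = 0.
  by rewrite -(sysE (fun=> 1)) Mx0 mxE.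
have := E (ord9_ 0); have := E (ord9_ 1); have := E (ord9_ 2); have := E (ord9_ 3);
have := E (ord9_ 4); have := E (ord9_ 5); have := E (ord9_ 6); have := E (ord9_ 7); have := E (ord9_ 8).
rewrite !sum_ord9 /dep_eqn /vdir /vtbl; cbn [nat_of_ord nth ord3_0 ord3_1 ord3_2].
move=> h8 h7 h6 h5 h4 h3 h2 h1 h0.
apply/matrixP => i j; rewrite ord1 mxE; move: i {E Mx0 j}.
by apply: ord9P; lra.
Qed.

Lemma sys0_wt : sys (fun=> 1) vdir *m (\col_j wt j) = delta_mx (ord9_ 8) 0.
Proof.
apply/matrixP => i j; rewrite ord1 sysE mxE andbT sum_ord9 !mxE.
move: i; apply: ord9P; rewrite /dep_eqn /vdir /vtbl /wt; cbn [nat_of_ord nth ord3_0 ord3_1 ord3_2 leq subn];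
 rewrite /= ?mulr1n ?mulr0n; lra.
Qed.

(** A product of two perturbed factors moves by at most [3 * eta], using [eta^2 <= eta]; rows 6 and
    7 are differences of two products. *)
Lemma dep_eqn_perturb (eta a : R) (u v : 'I_3 -> R) i : 0 <= eta -> eta <= 1 ->
  `|a - 1| <= eta -> (forall k, `|u k - v k| <= eta) -> (forall k, `|v k| <= 1) ->
  `|dep_eqn i a u - dep_eqn i 1 v| <= 6 * eta.
Proof.
move=> eta0 eta1 ha hu hv.
have prod (x x' y y' : R) : `|x - x'| <= eta -> `|y - y'| <= eta -> `|x'| <= 1 -> `|y'| <= 1 ->
    `|x * y - x' * y'| <= 3 * eta.
  move=> hx hy hx' hy'.
  have -> : x * y - x' * y' = (x - x') * (y - y') + (x - x') * y' + x' * (y - y') by ring.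
  have : `|(x - x') * (y - y')| <= eta * 1.
    by rewrite normrM ler_pM // (le_trans hy).
  have : `|(x - x') * y'| <= eta * 1 by rewrite normrM ler_pM.
  have : `|x' * (y - y')| <= 1 * eta by rewrite normrM ler_pM.
  have := ler_normD ((x - x') * (y - y') + (x - x') * y') (x' * (y - y')).
  have := ler_normD ((x - x') * (y - y')) ((x - x') * y').
  lra.
have one : `|1 : R| <= 1 by rewrite normr1.
have p1 k : `|a * u k - 1 * v k| <= 3 * eta by apply: prod.
have p2 k l : `|u k * u l - v k * v l| <= 3 * eta by apply: prod.
have p3 k l : `|(u k * u k - u l * u l) - (v k * v k - v l * v l)| <= 6 * eta.
  rewrite (_ : _ - _ = (u k * u k - v k * v k) - (u l * u l - v l * v l)); last by ring.
  by have := ler_normB (u k * u k - v k * v k) (u l * u l - v l * v l); have := p2 k k; have := p2 l l; lra.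
move: i; apply: ord9P; rewrite /dep_eqn; cbn [nat_of_ord].
1-3: by apply: le_trans (p1 _) _; lra.
1-3: by apply: le_trans (p2 _ _) _; lra.
1-2: exact: p3.
by rewrite subrr normr0; lra.
Qed.

Lemma vdir_le1 j k : `|vdir j k| <= 1.
Proof.
rewrite -(ler_pXn2r (n := 2)) ?nnegrE // real_normK ?num_real // expr1n -(vdir_unit j).
by rewrite (bigD1 k) //= lerDl sumr_ge0 // => l _; rewrite sqr_ge0.
Qed.

(** The equivalence gives existence and uniqueness at once. The lower bound [1 / 12] is the smallest
    weight in [wt], and [del / 6] absorbs the factor of [dep_eqn_perturb]. *)
Lemma robust_solution : exists2 eta : R, 0 < eta <= 1 &
  forall (a : 'I_9 -> R) (u : 'I_9 -> 'I_3 -> R),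
    (forall j, `|a j - 1| <= eta) -> (forall j k, `|u j k - vdir j k| <= eta) ->
    exists2 p : 'I_9 -> R, forall j, 0 < p j &
      forall p' : 'I_9 -> R,
        (forall i, \sum_j dep_eqn i (a j) (u j) * p' j = (i == ord9_ 8)%:R) <-> p' =1 p.
Proof.
have m0 : (0 : R) < 1 / 12 by lra.
have pm i : 1 / 12 <= (\col_j wt j : 'cV[R]_9) i 0.
  by rewrite mxE /wt; case: ifP => _; lra.
have [del del0 H] := perturbed_solution sys0_unit m0 pm.
exists (Num.min 1 (del / 6)); first by rewrite lt_min ge_min lexx ltr01 /= andbT divr_gt0.
move=> a u ha hu.
have [MU Mpos] : sys a u \in unitmx /\ forall x, sys a u *m x = sys (fun=> 1) vdir *m (\col_j wt j) ->
    forall i, 0 < x i 0.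
  apply: H => i j; rewrite !mxE.
  apply: le_trans (@dep_eqn_perturb (Num.min 1 (del / 6)) _ _ _ i _ _ (ha j) (hu j) (vdir_le1 j)) _.
  - by rewrite le_min ler01 divr_ge0 // ltW.
  - by rewrite ge_min lexx.
  - have : Num.min 1 (del / 6) <= del / 6 by rewrite ge_min lexx orbT.
    lra.
pose x := invmx (sys a u) *m (sys (fun=> 1) vdir *m (\col_j wt j)).
have Mx : sys a u *m x = delta_mx (ord9_ 8) 0 by rewrite /x mulmxA mulmxV // mul1mx sys0_wt.
exists (fun j => x j 0); first by apply: Mpos; rewrite Mx sys0_wt.
move=> p'; split=> [h j|h i].
  have -> : p' j = (\col_j p' j : 'cV_9) j 0 by rewrite mxE.
  congr (fun_of_matrix _ j 0); apply: (can_inj (mulKmx MU)); rewrite Mx.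
  apply/matrixP => i k; rewrite ord1 sysE !mxE andbT -h.
  by apply: eq_bigr => l _; rewrite mxE.
under eq_bigr do rewrite h.
by rewrite -sysE Mx mxE andbT.
Qed.

(** * Angles between unit vectors of R^4 *)

Section Geometry.
(** The vector [(k, s v)] is the prescribed one and [(a, w)] the actual one; [t] is the cosine of
    their angle, whose sine is at most [eps]. *)
Variables (s eps k a t : R) (v w : 'I_3 -> R).

Lemma dot3_sqr_le : (\sum_l v l * w l) ^+ 2 <= (\sum_l v l ^+ 2) * (\sum_l w l ^+ 2).
Proof.
rewrite !sum_ord3; move: (v ord3_0) (v ord3_1) (v ord3_2) (w ord3_0) (w ord3_1) (w ord3_2) => v0 v1 v2 w0 w1 w2.
rewrite -subr_ge0 (_ : _ - _ = (v0 * w1 - v1 * w0) ^+ 2 + (v0 * w2 - v2 * w0) ^+ 2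
  + (v1 * w2 - v2 * w1) ^+ 2); last by ring.
by rewrite !addr_ge0 ?sqr_ge0.
Qed.

Hypothesis v1 : \sum_l v l ^+ 2 = 1.
Hypothesis s0 : 0 <= s.
Hypothesis eps0 : 0 <= eps.
Hypothesis k_ge0 : 0 <= k.
Hypothesis ks : k ^+ 2 + s ^+ 2 = 1.
Hypothesis aw : a ^+ 2 + \sum_l w l ^+ 2 = 1.
Hypothesis tE : t = k * a + s * \sum_l v l * w l.
Hypothesis t0 : 0 <= t.
Hypothesis te : 1 - t ^+ 2 <= eps ^+ 2.

(** The squared chord is [2 - 2 * t], and [1 - t <= 1 - t^2] for [t] in [0, 1]. *)
Lemma chord_le : (a - k) ^+ 2 + \sum_l (w l - s * v l) ^+ 2 <= 2 * eps ^+ 2.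
Proof.
have E : (a - k) ^+ 2 + \sum_l (w l - s * v l) ^+ 2 = 2 - 2 * t.
  move: aw v1; rewrite tE !sum_ord3 => aw' v1'.
  transitivity ((a ^+ 2 + (w ord3_0 ^+ 2 + w ord3_1 ^+ 2 + w ord3_2 ^+ 2)) +
    (k ^+ 2 + s ^+ 2 * (v ord3_0 ^+ 2 + v ord3_1 ^+ 2 + v ord3_2 ^+ 2))
    - 2 * (k * a + s * (v ord3_0 * w ord3_0 + v ord3_1 * w ord3_1 + v ord3_2 * w ord3_2))); first by ring.
  by rewrite aw' v1' mulr1 ks; ring.
have E0 : 0 <= 2 - 2 * t by rewrite -E addr_ge0 ?sqr_ge0 // sumr_ge0 // => l _; rewrite sqr_ge0.
rewrite E; move: te t0; nra.
Qed.

(* Subadditivity of the sine: with [s = sin x], [om = sin y] one has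
   [om = s cos (y - x) + k sin (y - x)], and symmetrically for [s]. *)
Lemma radius_bounds (om : R) : 0 <= om -> om ^+ 2 = \sum_l w l ^+ 2 ->
  om <= s + eps /\ s <= om + eps.
Proof.
move=> om0 omE; pose y := \sum_l v l * w l; have tE' : t = k * a + s * y := tE.
have yom : y <= om.
  have := dot3_sqr_le; rewrite v1 mul1r -omE -/y => yy.
  by apply: le_trans (ler_norm _) _; rewrite -(ler_pXn2r (n := 2)) ?nnegrE // real_normK ?num_real.
have aE : `|a| ^+ 2 = 1 - om ^+ 2 by rewrite real_normK ?num_real //; move: aw; rewrite -omE; lra.
set A := `|a| in aE; have A0 : 0 <= A by rewrite /A.
(* Replacing [a] by its modulus and [y] by [om] only increases the cosine and reduces to plane
   angles: [t' = cos (y - x)] and [d = sin (y - x)] for the angles x and y with sines [s] and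
   [om]. *)
pose t' := k * A + s * om.
have tt' : t <= t'.
  by rewrite tE' /t' lerD // ler_wpM2l //; exact: ler_norm.
pose d := k * om - s * A.
have td : t' ^+ 2 + d ^+ 2 = 1.
  rewrite /t' /d; transitivity ((k ^+ 2 + s ^+ 2) * (A ^+ 2 + om ^+ 2)); first by ring.
  by rewrite ks aE; ring.
have t'0 : 0 <= t' by apply: le_trans tt'.
have t'1 : t' <= 1 by have := sqr_ge0 d; move: td; nra.
have k_le1 : k <= 1 by have := sqr_ge0 s; move: ks k_ge0; nra.
have A1 : A <= 1 by have := sqr_ge0 om; move: aE A0; nra.
have : `|d| <= eps.
  rewrite -(ler_pXn2r (n := 2)) ?nnegrE // real_normK ?num_real //.
  by move: td te tt' t0; nra.
rewrite ler_norml => /andP[d1 d2].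
have omd : om = s * t' + k * d.
  transitivity (om * (k ^+ 2 + s ^+ 2)); first by rewrite ks mulr1.
  by rewrite /t' /d; ring.
have sd : s = om * t' - A * d.
  transitivity (s * (A ^+ 2 + om ^+ 2)); first by rewrite aE; ring.
  by rewrite /t' /d; ring.
have small (x : R) : 0 <= x -> x <= 1 -> x * d <= eps /\ - (x * d) <= eps.
  by move=> x0 x1; move: d1 d2 eps0; split; nra.
have [kd _] := small k k_ge0 k_le1; have [_ Ad] := small A A0 A1.
have st : s * t' <= s by rewrite ler_piMr.
have ot : om * t' <= om by rewrite ler_piMr.
by split; [rewrite [leLHS]omd | rewrite [leLHS]sd]; lra.
Qed.

End Geometry.
End Perturbation.

(** * The remnant channel *)

Section Remnant.
Variable R : realType.
Local Notation C := R[i].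

Lemma uchM (A B : 'M[C]_2) rho : uch A (uch B rho) = uch (A *m B) rho.
Proof. by rewrite /uch adjmxM !mulmxA. Qed.

Lemma choi_comp_uch (A B : 'M[C]_2) : choi (uch A \o uch B) = choi (uch (A *m B)).
Proof. by apply/matrixP => i j; rewrite [LHS]mxE [RHS]mxE /= uchM. Qed.

Lemma overlap_mulr (A B W : 'M[C]_2) : W \is unitarymx ->
  overlap (A *m W) (B *m W) = overlap A B.
Proof.
move=> WU; rewrite /overlap adjmxM -mulmxA mxtrace_mulC !mulmxA.
by rewrite (mulmx_unitaryK _ WU).
Qed.

Lemma mag_realN (V : 'M[C]_2) r : mag_real V r -> mag_real V (fun a => - r a).
Proof. by move=> h a b; rewrite h mulrNN. Qed.

(** Overlaps are invariant under right multiplication by the inverse of [Uh], so the diamond bound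
    controls the angle between [e] and [r]. The free sign of [r] is used to make the inner product
    nonnegative. *)
Lemma remnant_vector (Uh A B : 'M[C]_2) (e : 'I_4 -> R) (eps : R) :
  Uh \is unitarymx -> A \is unitarymx -> B \is unitarymx ->
  rc (1 / 2) *: mb (choi (uch A \o uch (adjmx Uh))) = \matrix_(a, b) rc (e a * e b) ->
  diamond (chsub (uch A) (uch B)) / 2 <= eps ->
  exists r, [/\ mag_real (B *m adjmx Uh) r, \sum_a r a ^+ 2 = 1,
    0 <= \sum_a e a * r a & 1 - (\sum_a e a * r a) ^+ 2 <= eps ^+ 2].
Proof.
move=> UhU AU BU; rewrite choi_comp_uch mb_choi_uch => eE Dle.
have UhaU := unitarymx_adjmx UhU.
have he : mag_real (A *m adjmx Uh) e.
  by move=> a b; move/matrixP/(_ a b): eE; rewrite !mxE.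
have [r [hr r1]] := unitary_mag_real (mul_unitarymx BU UhaU).
have := overlap_mag he hr; rewrite (overlap_mulr _ _ UhaU) => ov.
have le := diamond_unitary_sub AU BU ov Dle.
have [t0|t0] := leP 0 (\sum_a e a * r a); first by exists r.
have E : \sum_a e a * - r a = - \sum_a e a * r a.
  by rewrite -sumrN; apply: eq_bigr => a _; rewrite mulrN.
exists (fun a => - r a); split; rewrite ?E ?sqrrN ?oppr_ge0 ?(ltW t0) //.
  exact: mag_realN.
by under eq_bigr do rewrite sqrrN.
Qed.

(** * The depolarizing condition as a linear system in the weights *)

Section Linear.
Variables (r : 'I_9 -> 'I_4 -> R) (s : R) (p : 'I_9 -> R).
Hypothesis s0 : s != 0.
Hypothesis r1 : forall j, \sum_a r j a ^+ 2 = 1.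

Let S a b := \sum_j p j * (r j a * r j b).
(** With [s = c * eps] this rescaling keeps the system close to the unperturbed one however small
    [eps] is. *)
Let u j (k : 'I_3) : R := r j (lift ord0 k) / s.

Let SC a b : S a b = S b a.
Proof. by apply: eq_bigr => j _; rewrite [r j a * _]mulrC. Qed.

(** The trace fixes the one diagonal entry that the equations leave open, as [1 - 3 * q]. *)
Let S_tr : S ord4_0 ord4_0 + S ord4_1 ord4_1 + S ord4_2 ord4_2 + S ord4_3 ord4_3 = \sum_j p j.
Proof.
rewrite -!big_split /=; apply: eq_bigr => j _.
by rewrite -[RHS]mulr1 -(r1 j) sum_ord4; ring.
Qed.

Let rowE i : \sum_j dep_eqn i (r j ord0) (u j) * p j =
  match nat_of_ord i with
  | 0 => S ord4_0 ord4_1 / s | 1 => S ord4_0 ord4_2 / s | 2 => S ord4_0 ord4_3 / s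
  | 3 => S ord4_1 ord4_2 / s ^+ 2 | 4 => S ord4_1 ord4_3 / s ^+ 2 | 5 => S ord4_2 ord4_3 / s ^+ 2
  | 6 => (S ord4_1 ord4_1 - S ord4_2 ord4_2) / s ^+ 2 | 7 => (S ord4_1 ord4_1 - S ord4_3 ord4_3) / s ^+ 2
  | _ => \sum_j p j
  end.
Proof.
have u0 j : u j ord3_0 = r j ord4_1 / s by congr (r j _ / s); apply/val_inj.
have u1 j : u j ord3_1 = r j ord4_2 / s by congr (r j _ / s); apply/val_inj.
have u2 j : u j ord3_2 = r j ord4_3 / s by congr (r j _ / s); apply/val_inj.
have r0 j : r j ord0 = r j ord4_0 by congr (r j _); apply/val_inj.
move: i; apply: ord9P; rewrite /dep_eqn; cbn [nat_of_ord]; rewrite /S -?sumrB ?mulr_suml;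
  by apply: eq_bigr => j _; rewrite ?u0 ?u1 ?u2 ?r0; field.
Qed.

Lemma eqn_depolarizing :
  (forall i, \sum_j dep_eqn i (r j ord0) (u j) * p j = (i == ord9_ 8)%:R) ->
  \sum_j p j = 1 /\
  forall a b, \sum_j p j * (r j a * r j b) = depk (\sum_j p j * (r j ord4_1 * r j ord4_1)) a * (a == b)%:R.
Proof.
move=> h; have h' i := etrans (esym (rowE i)) (h i).
have z1 x : x / s = 0 -> x = 0 by move/eqP; rewrite mulf_eq0 invr_eq0 (negPf s0) orbF => /eqP.
have z2 x : x / s ^+ 2 = 0 -> x = 0.
  by move/eqP; rewrite mulf_eq0 invr_eq0 expf_eq0 (negPf s0) orbF => /eqP.
have p1 : \sum_j p j = 1 := h' (ord9_ 8).
have S01 := z1 _ (h' (ord9_ 0)); have S02 := z1 _ (h' (ord9_ 1)); have S03 := z1 _ (h' (ord9_ 2)).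
have S12 := z2 _ (h' (ord9_ 3)); have S13 := z2 _ (h' (ord9_ 4)); have S23 := z2 _ (h' (ord9_ 5)).
have S22 := z2 _ (h' (ord9_ 6)); have S33 := z2 _ (h' (ord9_ 7)).
split=> // a b; rewrite -/(S a b) -/(S ord4_1 ord4_1).
have S10 := etrans (SC ord4_1 ord4_0) S01; have S20 := etrans (SC ord4_2 ord4_0) S02.
have S30 := etrans (SC ord4_3 ord4_0) S03; have S21 := etrans (SC ord4_2 ord4_1) S12.
have S31 := etrans (SC ord4_3 ord4_1) S13; have S32 := etrans (SC ord4_3 ord4_2) S23.
have := S_tr; rewrite p1 => tr1.
by move: a b; apply: ord4P; apply: ord4P; rewrite /depk !(eqxx, eq_ord4) ?mulr1 ?mulr0 //; lra.
Qed.

Lemma depolarizing_eqn (q : R) : \sum_j p j = 1 ->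
  (forall a b, \sum_j p j * (r j a * r j b) = depk q a * (a == b)%:R) ->
  forall i, \sum_j dep_eqn i (r j ord0) (u j) * p j = (i == ord9_ 8)%:R.
Proof.
move=> p1 h i; rewrite rowE p1 /S !h /depk !(eqxx, eq_ord4) !mulr0 !mul0r !subrr !mul0r.
by move: i; apply: ord9P.
Qed.

Lemma depolarizing_param (q : R) :
  (forall a b, \sum_j p j * (r j a * r j b) = depk q a * (a == b)%:R) ->
  3 * q = \sum_j p j * \sum_k r j (lift ord0 k) ^+ 2.
Proof.
have l0 : lift ord0 ord3_0 = ord4_1 by exact/val_inj.
have l1 : lift ord0 ord3_1 = ord4_2 by exact/val_inj.
have l2 : lift ord0 ord3_2 = ord4_3 by exact/val_inj.
move=> h; have := h ord4_1 ord4_1; have := h ord4_2 ord4_2; have := h ord4_3 ord4_3.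
rewrite /depk !(eqxx, eq_ord4) !mulr1 => h3 h2 h1.
transitivity (q + q + q); first by ring.
rewrite -{1}h1 -{1}h2 -h3 -!big_split /=; apply: eq_bigr => j _.
by rewrite sum_ord3 l0 l1 l2; ring.
Qed.

End Linear.

Lemma mixch_uch p U (Uh rho : 'M[C]_2) :
  (mixch p U \o uch (adjmx Uh)) rho = \sum_j rc (p j) *: uch (U j *m adjmx Uh) rho.
Proof. by apply: eq_bigr => j _; rewrite uchM. Qed.

(** Undoing [Uh] shows the mixture to be the depolarizing channel applied after [uch Uh], so
    [diamond_depolarizing_sub] applies and half of [6 * q] remains. *)
Lemma diamond_remnant p U (Uh : 'M[C]_2) (q : R) : Uh \is unitarymx -> 0 <= q ->
  (forall rho, (mixch p U \o uch (adjmx Uh)) rho = rc (1 - 3 * q) *: rho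
      + rc q *: (pX R *m rho *m pX R + pY R *m rho *m pY R + pZ R *m rho *m pZ R)) ->
  diamond (chsub (uch Uh) (mixch p U)) / 2 = 3 * q.
Proof.
move=> UhU q_ge0 dep; rewrite (@diamond_depolarizing_sub _ Uh q) //; first by field.
move=> rho; rewrite /chsub.
have -> : mixch p U rho = (mixch p U \o uch (adjmx Uh)) (uch Uh rho).
  by rewrite /= uchM (adj_unitarymx UhU) /uch adjmx1 mul1mx mulmx1.
rewrite dep; under [RHS]eq_bigr => k _ do rewrite -uchM /(uch (sig R k)) adj_sig.
rewrite sum_ord4 /depc /sig; cbn [nat_of_ord nth]; rewrite mul1mx mulmx1 /=.
move: (uch Uh rho) => x; move: (pX R *m x *m pX R) (pY R *m x *m pY R) (pZ R *m x *m pZ R) => y z t.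
rewrite rmorphB rmorph1 !rmorphN.
by apply/matrixP => i j; rewrite !mxE; ring.
Qed.

(** A deviation of [2 * eps], divided by [c * eps], is exactly [eta] for [c = 2 / eta]. The bound on
    [eps] gives [c * eps <= eta^2 / 4], which brings the first coordinate within [eta] of 1. *)
Lemma gate_estimates (eta c eps : R) (v : 'I_3 -> R) (r : 'I_4 -> R) :
  0 < eta -> eta <= 1 -> c = 2 / eta -> 0 < eps -> eps <= eta ^+ 3 / 8 ->
  \sum_k v k ^+ 2 = 1 -> \sum_a r a ^+ 2 = 1 ->
  0 <= \sum_a ehat c eps v a * r a ->
  1 - (\sum_a ehat c eps v a * r a) ^+ 2 <= eps ^+ 2 ->
  [/\ `|r ord0 - 1| <= eta,
      forall k, `|r (lift ord0 k) / (c * eps) - v k| <= eta,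
      ((c - 1) * eps) ^+ 2 <= \sum_k r (lift ord0 k) ^+ 2 &
      \sum_k r (lift ord0 k) ^+ 2 <= ((c + 1) * eps) ^+ 2].
Proof.
move=> eta0 eta1 cE eps0 epsle v1 r1 t0 te.
set s := c * eps.
have c2 : 2 <= c by rewrite cE ler_pdivlMr //; lra.
have sgt0 : 0 < s by rewrite mulr_gt0 //; lra.
have sle : s <= eta ^+ 2 / 4.
  apply: (@le_trans _ _ (c * (eta ^+ 3 / 8))); first by rewrite ler_wpM2l //; lra.
  by rewrite cE le_eqVlt; apply/orP; left; apply/eqP; field; rewrite gt_eqF.
have eta2 : eta ^+ 2 <= eta by rewrite expr2 ler_piMl // ltW.
have eta3 : eta ^+ 3 <= eta by rewrite exprS ler_piMr ?(ltW eta0) // (le_trans eta2).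
have s1 : s <= 1 by lra.
have ss1 : s ^+ 2 <= s by rewrite expr2 ler_piMl // ltW.
set k := Num.sqrt (1 - s ^+ 2).
have k0 : 0 <= k by apply: sqrtr_ge0.
have ks : k ^+ 2 + s ^+ 2 = 1 by rewrite sqr_sqrtr ?subrK // subr_ge0; lra.
have kle1 : k <= 1 by have := sqr_ge0 s; move: ks k0; nra.
have dotE : \sum_a ehat c eps v a * r a = k * r ord0 + s * \sum_l v l * r (lift ord0 l).
  rewrite big_ord_recl mulr_sumr; congr (_ + _); apply: eq_bigr => l _.
  by rewrite /ehat /= -/s inord_val mulrA.
have aw : r ord0 ^+ 2 + \sum_l r (lift ord0 l) ^+ 2 = 1 by rewrite -r1 [RHS]big_ord_recl.
have chord := chord_le v1 ks aw dotE t0 te.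
have sq2 (x : R) : x ^+ 2 <= 2 * eps ^+ 2 -> `|x| <= 2 * eps.
  move=> h; rewrite -(ler_pXn2r (n := 2)) ?nnegrE ?mulr_ge0 ?(ltW eps0) //.
  by rewrite real_normK ?num_real // exprMn; have := sqr_ge0 eps; lra.
have sumw0 : 0 <= \sum_l (r (lift ord0 l) - s * v l) ^+ 2.
  by rewrite sumr_ge0 // => l _; rewrite sqr_ge0.
pose om := Num.sqrt (\sum_l r (lift ord0 l) ^+ 2).
have omE : om ^+ 2 = \sum_l r (lift ord0 l) ^+ 2.
  by rewrite sqr_sqrtr // sumr_ge0 // => l _; rewrite sqr_ge0.
have om0 : 0 <= om by apply: sqrtr_ge0.
have [omu oml] := radius_bounds v1 (ltW sgt0) (ltW eps0) k0 ks aw dotE t0 te om0 omE.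
have ce0 : 0 <= (c - 1) * eps by rewrite mulr_ge0 ?(ltW eps0) //; lra.
split.
- have ha : `|r ord0 - k| <= 2 * eps by apply: sq2; lra.
  (* Since [0 <= k <= 1], one has [1 - k <= 1 - k^2 = s^2]. *)
  have hk : `|k - 1| <= s ^+ 2.
    by rewrite ler0_norm; move: ks k0 kle1; nra.
  have := ler_normD (r ord0 - k) (k - 1); rewrite addrA subrK.
  lra.
- move=> l; have hw : `|r (lift ord0 l) - s * v l| <= 2 * eps.
    apply: sq2; apply: le_trans chord.
    rewrite (bigD1 l) //= -[leLHS]add0r lerD ?sqr_ge0 // lerDl sumr_ge0 // => l' _.
    by rewrite sqr_ge0.
  have -> : r (lift ord0 l) / s - v l = (r (lift ord0 l) - s * v l) / s.
    by field; rewrite gt_eqF.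
  rewrite normrM normfV (gtr0_norm sgt0) ler_pdivrMr //.
  by apply: le_trans hw _; rewrite /s cE mulrA mulrCA divff ?mulr1 // gt_eqF.
- by rewrite -omE ler_pXn2r ?nnegrE //; rewrite mulrBl mul1r -/s; lra.
- have : 0 <= (c + 1) * eps by rewrite mulr_ge0 ?(ltW eps0) //; lra.
  by move=> h; rewrite -omE ler_pXn2r ?nnegrE // mulrDl mul1r -/s.
Qed.

End Remnant.

Theorem theoremS2 (R : realType) :
  exists (c eps0 : R) (v : 'I_9 -> 'I_3 -> R),
    [/\ 0 < c, 0 < eps0 & forall j, \sum_(k < 3) v j k ^+ 2 = 1] /\
    forall (Uh : 'M[R[i]]_2) (eps : R) (Uhat U : 'I_9 -> 'M[R[i]]_2),
      Uh \is unitarymx ->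
      0 < eps -> eps <= eps0 ->
      (forall j, Uhat j \is unitarymx) ->
      (forall j, rc (1 / 2) *: mb (choi (uch (Uhat j) \o uch (adjmx Uh)))
                 = \matrix_(a, b) rc (ehat c eps (v j) a * ehat c eps (v j) b)) ->
      (forall j, U j \is unitarymx) ->
      (forall j, diamond (chsub (uch (Uhat j)) (uch (U j))) / 2 <= eps) ->
      let feas := fun p : 'I_9 -> R =>
        probdist p /\ depolarizing (mixch p U \o uch (adjmx Uh)) in
      let D := fun p : 'I_9 -> R => diamond (chsub (uch Uh) (mixch p U)) / 2 in
      [/\ exists p, feas p,
          exists p, feas p /\ (forall p', feas p' -> D p <= D p')
        & forall p, feas p -> (forall p', feas p' -> D p <= D p') ->
            ((c - 1) * eps) ^+ 2 <= D p /\ D p <= ((c + 1) * eps) ^+ 2].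
Proof.
have [eta /andP[eta0 eta1] robust] := robust_solution R.
exists (2 / eta), (eta ^+ 3 / 8), (@vdir R); split.
  by split=> [||j]; rewrite ?divr_gt0 ?exprn_gt0 //; apply: vdir_unit.
move=> Uh eps Uhat U UhU eps_gt0 eps_le UhatU hatE UU Dle feas D.
set c := 2 / eta in hatE *.
have rem j := remnant_vector UhU (UhatU j) (UU j) (hatE j) (Dle j).
have [r hr] := boolp.choice rem.
have est j : [/\ `|r j ord0 - 1| <= eta,
      forall k, `|r j (lift ord0 k) / (c * eps) - vdir R j k| <= eta,
      ((c - 1) * eps) ^+ 2 <= \sum_k r j (lift ord0 k) ^+ 2 &
      \sum_k r j (lift ord0 k) ^+ 2 <= ((c + 1) * eps) ^+ 2].
  have [_ r1 t0 te] := hr j.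
  exact: gate_estimates eta0 eta1 erefl eps_gt0 eps_le (vdir_unit R j) r1 t0 te.
have s0 : c * eps != 0 by rewrite mulf_neq0 ?(gt_eqF eps_gt0) // gt_eqF ?divr_gt0.
have r1 j : \sum_a r j a ^+ 2 = 1 by have [] := hr j.
have Vr j : mag_real (U j *m adjmx Uh) (r j) by have [] := hr j.
have ha j : `|r j ord0 - 1| <= eta by have [] := est j.
have hu j k : `|r j (lift ord0 k) / (c * eps) - vdir R j k| <= eta.
  by have [_ /(_ k)] := est j.
have [p p_gt0 p_uniq] := robust _ _ ha hu.
(* A feasible point satisfies all nine equations, hence is [p]; its distance is the average of the
   squared radii [|w_j|^2]. *)
have feasE p' : feas p' -> p' =1 p /\ D p' = \sum_j p' j * \sum_k r j (lift ord0 k) ^+ 2.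
  move=> [[p'0 p'1] [q [q_ge0 dep]]].
  have dep' rho := etrans (esym (mixch_uch p' U Uh rho)) (dep rho).
  have prE := mag_sum_of_depolarizing Vr dep'.
  split; first by apply/p_uniq; apply: depolarizing_eqn p'1 prE.
  by rewrite -(depolarizing_param prE); apply: diamond_remnant.
have feas_p : feas p.
  have [p1 prE] := eqn_depolarizing s0 r1 (proj2 (p_uniq p) (fun=> erefl)).
  split; first by split=> // j; apply: ltW.
  exists (\sum_j p j * (r j ord4_1 * r j ord4_1)); split.
    by apply: sumr_ge0 => j _; rewrite mulr_ge0 ?(ltW (p_gt0 j)) // -expr2 sqr_ge0.
  by move=> rho; rewrite mixch_uch; apply: depolarizing_mix.
split; first by exists p.
  exists p; split; [exact: feas_p | move=> p' /feasE[p'p ->]]; have [_ ->] := feasE _ feas_p.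
  by rewrite (eq_bigr _ (fun j _ => congr1 (fun x => x * _) (p'p j))).
move=> p' fp' _; have [_ ->] := feasE _ fp'; have [[p'0 p'1] _] := fp'.
(* Each bound is rewritten as an average over [p'], so that the gate estimates can be compared term
   by term. *)
have const (x : R) : x = \sum_j p' j * x by rewrite -mulr_suml p'1 mul1r.
split; [rewrite [leLHS]const | rewrite [leRHS]const]; apply: ler_sum => j _;
  by rewrite ler_wpM2l //; have [] := est j.
Qed.
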